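(* Let $p\ge 2$ be an integer and let $Y\subset\mathbb{T}$ be a nonempty compact subset invariant under $T_p$, and suppose $T_p\colon Y\to Y$ has positive topological entropy. Then for every Følner sequence $(F_m)_{m\in\mathbb{N}}$ of the multiplicative semigroup $\mathbb{N}$, there exists a set $J\subset\mathbb{N}$ such that $$\lim_{m\to\infty}\frac{|J\cap F_m|}{|F_m|}=1\quad\text{and}\quad \lim_{n\to\infty,\ n\in J} nY=\mathbb{T}\ \text{ in }\mathcal{K}(\mathbb{T}).$$
   Context: $\mathbb{N}=\{1,2,\dots\}$, $\mathbb{T}=\mathbb{R}/\mathbb{Z}$, $T_n\colon\mathbb{T}\to\mathbb{T}$ is $T_n(x)=nx \bmod 1$, and $nY=T_n(Y)=\{ny:y\in Y\}$. A set $Y$ is invariant under $T_p$ if $T_p(Y)=Y$. $\mathcal{K}(\mathbb{T})$ is the space of nonempty compact subsets of $\mathbb{T}$ with the Hausdorff metric. A Følner sequence for the multiplicative semigroup $\mathbb{N}$ is a sequence of nonempty finite sets $F_m\subset\mathbb{N}$ such that for every $k\in\mathbb{N}$, $|kF_m\,\Delta\,F_m|/|F_m|\to0$ as $m\to\infty$, where $kF_m=\{kn:n\in F_m\}$. *)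

(* Defs.v *)
From HB Require Import structures.
From mathcomp Require Import all_boot all_order all_algebra finmap.
From mathcomp Require Import generic_quotient ring_quotient.
From mathcomp Require Import all_classical all_reals all_analysis.
Import Order.TTheory GRing.Theory Num.Theory.
Import numFieldNormedType.Exports.

Set Implicit Arguments.
Unset Strict Implicit.
Unset Printing Implicit Defensive.

Local Open Scope classical_set_scope.
Local Open Scope ring_scope.
Local Open Scope quotient_scope.

Definition integers (R : realType) : {pred R} := [pred x | x \is a Num.int].
Arguments integers : clear implicits.

Fact integers_zmod_closed (R : realType) : zmod_closed (integers R).
Proof. by split=> [|x y]; rewrite !inE ?rpred0//; exact: rpredB. Qed.

HB.instance Definition _ (R : realType) :=
  GRing.isZmodClosed.Build R (integers R) (@integers_zmod_closed R).

Definition circle (R : realType) : Type :=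
  {ideal_quot integers R}.

HB.instance Definition _ (R : realType) := GRing.Zmodule.on (circle R).

Section circle.
Context {R : realType}.
Implicit Types (x y : circle R) (r s : R).

Definition circle_proj (r : R) : circle R := \pi_({ideal_quot integers R}) r.

Lemma circle_projE r s : circle_proj r = circle_proj s <-> r - s \is a Num.int.
Proof.
split=> [/eqP|h]; first by rewrite /circle_proj -Quotient.idealrBE.
by apply/eqP; rewrite /circle_proj -Quotient.idealrBE.
Qed.

Lemma circle_projD r s :
  circle_proj (r + s) = circle_proj r + circle_proj s.
Proof. exact: pi_addr. Qed.

Lemma circle_projN r : circle_proj (- r) = - circle_proj r.
Proof. exact: pi_oppr. Qed.

Lemma circle_proj_surj x : exists r, circle_proj r = x.
Proof. by exists (repr x); exact: reprK. Qed.

(* This is the distance from any representative of x to the nearest integer,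
   so the metric below is the quotient metric of R / Z. *)
Definition circle_norm x : R := inf [set `|r| | r in circle_proj @^-1` [set x]].

Let norm_lb x : has_lbound [set `|r| | r in circle_proj @^-1` [set x]].
Proof. by exists 0 => _ [r _ <-]. Qed.

Lemma circle_norm_has_inf x :
  has_inf [set `|r| | r in circle_proj @^-1` [set x]].
Proof.
split; last exact: norm_lb.
by have [r rx] := circle_proj_surj x; exists `|r|; exists r.
Qed.

Lemma circle_norm_le r : circle_norm (circle_proj r) <= `|r|.
Proof. by apply: ge_inf; [exact: norm_lb|exists r]. Qed.

Lemma circle_norm_adh x (e : R) : 0 < e ->
  exists2 r, circle_proj r = x & `|r| < circle_norm x + e.
Proof.
by move=> e0; have [_ [r rx <-] lt] := inf_adherent e0 (circle_norm_has_inf x);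
  exists r.
Qed.

Lemma circle_norm_ge0 x : 0 <= circle_norm x.
Proof.
by apply: lb_le_inf; [case: (circle_norm_has_inf x)|move=> _ [r _ <-]].
Qed.

Lemma circle_norm0 : circle_norm 0 = 0.
Proof.
have p0 : circle_proj 0 = 0 by exact: pi_zeror.
apply/eqP; rewrite eq_le circle_norm_ge0 andbT -p0.
by rewrite (le_trans (circle_norm_le 0))// normr0.
Qed.

Lemma circle_norm_triangle x y :
  circle_norm (x + y) <= circle_norm x + circle_norm y.
Proof.
apply/ler_addgt0Pl => e e0; have e20 : 0 < e / 2 by rewrite divr_gt0.
have [r <- hr] := circle_norm_adh x e20.
have [s <- hs] := circle_norm_adh y e20.
rewrite -circle_projD (le_trans (circle_norm_le _))//.
rewrite (le_trans (ler_normD _ _))// (le_trans (lerD (ltW hr) (ltW hs)))//.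
by rewrite addrACA -splitr addrC.
Qed.

Lemma circle_normN x : circle_norm (- x) = circle_norm x.
Proof.
have h z : circle_norm (- z) <= circle_norm z.
  apply/ler_addgt0Pl => e e0; have [r <- hr] := circle_norm_adh z e0.
  rewrite -circle_projN (le_trans (circle_norm_le _))// normrN addrC.
  exact: ltW.
by apply/eqP; rewrite eq_le h/= -{1}[x]opprK h.
Qed.

Lemma circle_norm_eq0 x : circle_norm x = 0 -> x = 0.
Proof.
move=> x0.
have [r rx rlt] := @circle_norm_adh x (2^-1) ltac:(by rewrite invr_gt0).
rewrite x0 add0r in rlt.
suff r0 : r = 0 by rewrite -rx r0; exact: pi_zeror.
apply/normr0_eq0/eqP; rewrite eq_le normr_ge0 andbT.
apply/ler_addgt0Pl => e e0.
have m0 : 0 < Num.min e 2^-1 by rewrite lt_min e0 invr_gt0 ltr0n.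
have [s sx] := circle_norm_adh x m0; rewrite x0 add0r lt_min => /andP[se s2].
have /circle_projE/intrP[k rs] : circle_proj r = circle_proj s by rewrite rx.
have : `|k%:~R : R| < 1.
  rewrite -rs (le_lt_trans (ler_normB _ _))//.
  by rewrite (lt_le_trans (ltrD rlt s2))// [leRHS](splitr 1) !mul1r.
rewrite -intr_norm (_ : 1 = 1%:~R)// ltr_int => k1.
have k0 : k = 0 by apply/eqP; rewrite -normr_le0 -ltzD1 add0r.
move/eqP: rs; rewrite k0 subr_eq0 => /eqP ->.
by rewrite addr0 ltW.
Qed.

Definition circle_dist x y : R := circle_norm (x - y).

Let distxx x : circle_dist x x = 0.
Proof. by rewrite /circle_dist subrr circle_norm0. Qed.

Let dist_positivity x y : circle_dist x y = 0 -> x = y.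
Proof. by move/circle_norm_eq0/eqP; rewrite subr_eq0 => /eqP. Qed.

Let dist_sym x y : circle_dist x y = circle_dist y x.
Proof. by rewrite /circle_dist -circle_normN opprB. Qed.

Let dist_triangle y x z :
  circle_dist x z <= circle_dist x y + circle_dist y z.
Proof.
by rewrite /circle_dist -(subrKA y x (- z)) circle_norm_triangle.
Qed.

HB.instance Definition _ := Choice.on (circle R).
HB.instance Definition _ := isMetric.Build R (circle R)
  distxx dist_positivity dist_sym dist_triangle.

Definition times (n : nat) (x : circle R) : circle R := x *+ n.

End circle.

Lemma lipschitz_mdist_continuous {R : realType} {X Y : metricType R}
    (f : X -> Y) (k : R) : 0 < k ->
  (forall x y, mdist (f x) (f y) <= k * mdist x y) -> continuous f.
Proof.
move=> k0 fk x; apply/metricType_numDomainType.cvgrPdist_lt => e e0.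
apply/metricType_numDomainType.nbhs_mdistP.
exists (e / k) => /= [|y]; first by rewrite divr_gt0.
by rewrite /= ltr_pdivlMr// mulrC; exact: le_lt_trans.
Qed.

Record hyperspace {R : realType} (X : metricType R) := Hyperspace {
  hyperspace_set :> set X;
  hyperspace_neq0 : hyperspace_set !=set0;
  hyperspace_compact : compact hyperspace_set }.

HB.instance Definition _ (R : realType) (X : metricType R) :=
  gen_eqMixin (hyperspace X).
HB.instance Definition _ (R : realType) (X : metricType R) :=
  gen_choiceMixin (hyperspace X).

Section hausdorff_metric.
Context {R : realType} {X : metricType R}.
Implicit Types (x y : X) (A B C : hyperspace X).

Definition point_dist x (B : set X) : R := inf [set mdist x b | b in B].

Definition excess (A B : set X) : R := sup [set point_dist a B | a in A].

Definition hausdorff_dist (A B : set X) : R :=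
  Num.max (excess A B) (excess B A).

Lemma hyperspace_inj A B : A = B :> set X -> A = B.
Proof.
case: A B => [A A0 cA] [B B0 cB] /= AB; subst B.
by congr Hyperspace; exact: Prop_irrelevance.
Qed.

Let lbd x (B : set X) : has_lbound [set mdist x b | b in B].
Proof. by exists 0 => _ [b _ <-]; exact: mdist_ge0. Qed.

Let hinf x B : has_inf [set mdist x b | b in B].
Proof.
by split; [have [b Bb] := hyperspace_neq0 B; exists (mdist x b); exists b
          |exact: lbd].
Qed.

Lemma point_dist_ge0 x B : 0 <= point_dist x B.
Proof.
by apply: lb_le_inf; [case: (hinf x B)|move=> _ [b _ <-]; exact: mdist_ge0].
Qed.

Lemma point_dist_le x b B : hyperspace_set B b -> point_dist x B <= mdist x b.
Proof. by move=> Bb; apply: ge_inf; [exact: lbd|exists b]. Qed.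

Lemma point_dist_adh x B (e : R) : 0 < e ->
  exists2 b, hyperspace_set B b & mdist x b < point_dist x B + e.
Proof.
by move=> e0; have [_ [b Bb <-] lt] := inf_adherent e0 (hinf x B); exists b.
Qed.

Lemma point_dist_triangle x y B : point_dist x B <= mdist x y + point_dist y B.
Proof.
apply/ler_addgt0Pl => e e0; have [b Bb lt] := point_dist_adh y B e0.
rewrite (le_trans (point_dist_le x Bb))//.
rewrite (le_trans (metric_triangle x y b))//.
by rewrite addrCA lerD2l addrC ltW.
Qed.

Lemma mdist_continuous y : continuous (fun x => mdist x y : R^o).
Proof.
apply: (@lipschitz_mdist_continuous R X R^o _ 1) => // x z; rewrite mul1r.
rewrite [leLHS](_ : _ = `|mdist z y - mdist x y|)//.
rewrite ler_norml lerBrDl !lerBlDr [leRHS]addrC metric_triangle/=.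
by rewrite (metric_sym x z) metric_triangle.
Qed.

Let has_sup_excess A B : has_sup [set point_dist a B | a in (A : set X)].
Proof.
split.
  by have [a Aa] := hyperspace_neq0 A; exists (point_dist a B); exists a.
have [b Bb] := hyperspace_neq0 B.
have := continuous_compact
  (continuous_subspaceT (@mdist_continuous b)) (@hyperspace_compact _ _ A).
move=> /compact_bounded[M [_ /(_ (M + 1))]].
rewrite ltrDl ltr01 => /(_ isT) h.
exists (M + 1) => _ [a Aa <-].
rewrite (le_trans (point_dist_le a Bb))// (le_trans (ler_norm _))//.
by apply: h; exists a.
Qed.

Lemma point_dist_excess a A B :
  hyperspace_set A a -> point_dist a B <= excess A B.
Proof.
by move=> Aa; apply: sup_upper_bound; [exact: has_sup_excess|exists a].
Qed.

Lemma excess_le A B (e : R) :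
  (forall a, hyperspace_set A a -> point_dist a B <= e) -> excess A B <= e.
Proof.
move=> h; apply: sup_le_ub; first by case: (has_sup_excess A B).
by move=> _ [a Aa <-]; exact: h.
Qed.

Lemma excess_ge0 A B : 0 <= excess A B.
Proof.
have [a Aa] := hyperspace_neq0 A.
exact: le_trans (point_dist_ge0 a B) (point_dist_excess B Aa).
Qed.

Lemma excess_triangle B A C : excess A C <= excess A B + excess B C.
Proof.
apply: excess_le => a Aa; apply/ler_addgt0Pl => e e0.
have [b Bb lt] := point_dist_adh a B e0.
rewrite (le_trans (point_dist_triangle a b C))//.
have h1 := point_dist_excess B Aa; have h2 := point_dist_excess C Bb.
by rewrite addrA lerD// (le_trans (ltW lt))// [leLHS]addrC lerD2l.
Qed.

Lemma excess_self A : excess A A = 0.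
Proof.
apply/eqP; rewrite eq_le excess_ge0 andbT; apply: excess_le => a Aa.
by rewrite (le_trans (point_dist_le a Aa))// mdistxx.
Qed.

Lemma excess_eq0 A B : excess A B = 0 -> A `<=` B.
Proof.
move=> AB0 a Aa.
have /closure_id -> : closed B.
  by apply: compact_closed; [exact: metric_hausdorff|exact: hyperspace_compact].
move=> U; rewrite -metricType_numDomainType.filter_from_mdist_nbhs.
move=> [e /= e0 eU]; have [b Bb lt] := point_dist_adh a B e0.
exists b; split => //; apply: eU => /=; apply: lt_le_trans lt _.
by rewrite -lerBrDr subrr -AB0 point_dist_excess.
Qed.

Let distxx A : hausdorff_dist A A = 0.
Proof. by rewrite /hausdorff_dist excess_self maxxx. Qed.

Let dist_positivity A B : hausdorff_dist A B = 0 -> A = B.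
Proof.
rewrite /hausdorff_dist => h; apply: hyperspace_inj.
have hAB : excess A B <= 0 by rewrite -h le_max lexx.
have hBA : excess B A <= 0 by rewrite -h le_max lexx orbT.
by apply/seteqP; split; apply: excess_eq0; apply/eqP;
  rewrite eq_le excess_ge0 andbT.
Qed.

Let dist_sym A B : hausdorff_dist A B = hausdorff_dist B A.
Proof. exact: maxC. Qed.

Let dist_triangle B A C :
  hausdorff_dist A C <= hausdorff_dist A B + hausdorff_dist B C.
Proof.
rewrite /hausdorff_dist ge_max; apply/andP; split.
  by rewrite (le_trans (excess_triangle B _ _))// lerD// le_max lexx.
by rewrite (le_trans (excess_triangle B _ _))// addrC lerD// le_max lexx orbT.
Qed.

HB.instance Definition _ := isMetric.Build R (hyperspace X)
  distxx dist_positivity dist_sym dist_triangle.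

End hausdorff_metric.

Section dilation.
Context {R : realType}.

Lemma times_continuous n : continuous (@times R n).
Proof.
apply: (@lipschitz_mdist_continuous R _ _ _ n.+1%:R) => // x y.
rewrite [leLHS](_ : _ = circle_norm (times n x - times n y))//.
rewrite [mdist x y](_ : _ = circle_norm (x - y))// /times -mulrnBl mulr_natl.
have h m (z : circle R) : circle_norm (z *+ m) <= circle_norm z *+ m.
  elim: m => [|m ih]; first by rewrite !mulr0n circle_norm0.
  by rewrite !mulrS (le_trans (circle_norm_triangle _ _))// lerD2l.
by rewrite (le_trans (h n _))// mulrS lerDr circle_norm_ge0.
Qed.

Lemma circle_proj_continuous : continuous (@circle_proj R : R^o -> circle R).
Proof.
apply: (@lipschitz_mdist_continuous R R^o _ _ 1) => // r s; rewrite mul1r.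
rewrite [leLHS](_ : _ = circle_norm (circle_proj r - circle_proj s))//.
by rewrite -circle_projN -circle_projD (le_trans (circle_norm_le _))// distrC.
Qed.

Lemma circle_compact : compact [set: circle R].
Proof.
have -> : [set: circle R] = @circle_proj R @` `[0, 1]%classic.
  apply/seteqP; split => // x _; have [r <-] := circle_proj_surj x.
  exists (r - (Num.floor r)%:~R).
    rewrite /= in_itv/= subr_ge0 floor_le/= lerBlDl.
    by have := ltW (floorD1_gt r); rewrite intrD.
  by apply/circle_projE; rewrite addrAC subrr add0r rpredN intr_int.
apply: continuous_compact; last exact: segment_compact.
exact: continuous_subspaceT circle_proj_continuous.
Qed.

Definition circle_full : hyperspace (circle R) :=
  Hyperspace (ex_intro _ (0 : circle R) I) circle_compact.

Lemma dilate_neq0 n (Y : hyperspace (circle R)) : times n @` Y !=set0.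
Proof.
by have [y Yy] := hyperspace_neq0 Y; exists (times n y); exists y.
Qed.

Lemma dilate_compact n (Y : hyperspace (circle R)) : compact (times n @` Y).
Proof.
apply: continuous_compact (@hyperspace_compact _ _ Y).
exact: continuous_subspaceT (@times_continuous n).
Qed.

Definition dilate n (Y : hyperspace (circle R)) : hyperspace (circle R) :=
  Hyperspace (@dilate_neq0 n Y) (@dilate_compact n Y).

End dilation.

Section entropy.
Context {R : realType} {X : metricType R}.
Variables (f : X -> X) (K : set X).

Definition bowen_dist (n : nat) (x y : X) : R :=
  \big[Num.max/0]_(i < n) mdist (iter i f x) (iter i f y).

Definition separated (n : nat) (e : R) (E : {fset X}) : Prop :=
  [set` E] `<=` K /\
  {in E &, forall x y, x != y -> e < bowen_dist n x y}.

Definition separation_number (n : nat) (e : R) : \bar R :=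
  ereal_sup [set (#|` E|)%:R%:E | E in separated n e].

Definition entropy_at (e : R) : \bar R :=
  limn_esup (fun n => ((n%:R^-1)%:E * lne (separation_number n e))%E).

(* The Bowen-Dinaburg entropy of f on an f-invariant K; entropy_at is
   nonincreasing in e > 0, so the limit exists in \bar R. *)
Definition topological_entropy : \bar R := lim (entropy_at e @[e --> 0^'+]).

End entropy.

Local Open Scope fset_scope.

Definition fset_scale (k : nat) (F : {fset nat}) : {fset nat} :=
  [fset (k * n)%N | n in F].

Definition fset_symdiff (A B : {fset nat}) : {fset nat} :=
  (A `\` B) `|` (B `\` A).

(* The positive integers are the semigroup: 0 is excluded from the F m. *)
Definition folner (R : realType) (F : nat -> {fset nat}) : Prop :=
  [/\ forall m, F m != fset0,
      forall m n, n \in F m -> (0 < n)%N &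
      forall k, (0 < k)%N ->
        (#|` fset_symdiff (fset_scale k (F m)) (F m)|%:R / #|` F m|%:R : R)
          @[m --> \oo] --> (0 : R)].

(* Main.v *)
Require Import Defs.
From HB Require Import structures.
From mathcomp Require Import all_boot all_order all_algebra finmap.
From mathcomp Require Import all_classical all_reals all_analysis.
From mathcomp Require Import ring lra zify.
Import Order.TTheory GRing.Theory Num.Theory.
Import numFieldNormedType.Exports.

Set Implicit Arguments.
Unset Strict Implicit.
Unset Printing Implicit Defensive.

Local Open Scope fset_scope.
Local Open Scope classical_set_scope.
Local Open Scope ring_scope.

(** The proof looks at the orbits [p^l x] of points [x] of [Y] and at the
    empirical measures [mu_n] of their dilates [n p^l x], for [l < N]. These
    points all lie in [n Y], so it is enough to show that for most [n] in
    [F m] the measure [mu_n] charges every arc of a given length. Here [m] is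
    fixed first, and [N] and [x] may depend on it.

    The average of the [mu_n] over [F m] is almost invariant under every
    dilation, since [F m] is a Folner set. Its cosine coefficients at nonzero
    frequencies are thus almost equal, as they are for a combination
    [c delta_0 + (1 - c) Haar]. This says nothing yet about the individual
    [mu_n], but each [mu_n] is also almost invariant under [T_p]. Hence, up to
    an edge effect, a function [g] and its average over [M] powers of a
    dilation by a power of [p] have the same integral against [mu_n]. For
    [g = sin (d x)] and [g = cos (d x) - cos x], which vanish at 0, the images
    of [g] are almost orthogonal with respect to the average measure, because
    their products are sums of cosines whose common coefficient cancels out.
    So the integrals of [g] against [mu_n] are small in mean square
    ([sum_sqr_fourier_le]), and by Chebyshev's inequality most [mu_n] look,
    up to a fixed frequency, like [c_n delta_0 + (1 - c_n) Haar] with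
    [c_n] the integral of [cos x]. A Fejer kernel centred in a gap of [n Y]
    then forces [c_n] to be close to 1 ([one_sub_avg_ccos_le]).

    Positive entropy excludes this. If for every [x] in [Y] some [n] in [F m]
    kept [n p^l x] close to 0 for most [l < N], then each orbit would be
    determined at a fixed scale by [n], an initial position and its rare
    excursions from 0. There are too few such codes compared with the
    exponential growth of separated sets ([card_near0_orbits_le]). The
    resulting lower bound on [1 - c_n] does not depend on [F m]
    ([entropy_gt0_orbit_avg]).

    Dilates at a given distance from the circle therefore have density 0
    along [F] ([far_dilates_rare]), and a diagonal argument yields [J]. *)

(** * Characters and distance on the circle *)

Section characters.
Context {R : realType}.
Implicit Types (x y z : circle R) (r : R).

Definition ccos x : R := cos (2 * pi * repr x).
Definition csin x : R := sin (2 * pi * repr x).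

Lemma cos_sin_int (k : int) r :
  cos (r + 2 * pi * k%:~R) = cos r /\ sin (r + 2 * pi * k%:~R) = sin r.
Proof.
have nat_case (n : nat) (s : R) :
    cos (s + 2 * pi * n%:R) = cos s /\ sin (s + 2 * pi * n%:R) = sin s.
  elim: n => [|n [IHc IHs]]; first by rewrite mulr0 addr0.
  have -> : s + 2 * pi * n.+1%:R = (s + 2 * pi * n%:R) + pi *+ 2.
    by rewrite -[n.+1]addn1 natrD -mulr_natl; ring.
  by rewrite cosD2pi sinD2pi.
case: k => n; first exact: nat_case.
have [hc hs] := nat_case n.+1 (r + 2 * pi * (Negz n)%:~R).
have e : r + 2 * pi * (Negz n)%:~R + 2 * pi * n.+1%:R = r.
  by rewrite NegzE mulrNz; ring.
by rewrite e in hc hs; rewrite hc hs.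
Qed.

Lemma repr_circle_proj r : exists k : int, repr (circle_proj r) = r + k%:~R.
Proof.
have /circle_projE/intrP[k hk] : circle_proj (repr (circle_proj r)) =
  circle_proj r by exact: reprK.
by exists k; rewrite -hk; ring.
Qed.

Lemma ccosE r : ccos (circle_proj r) = cos (2 * pi * r).
Proof.
have [k hk] := repr_circle_proj r.
by rewrite /ccos hk mulrDr (cos_sin_int k _).1.
Qed.

Lemma csinE r : csin (circle_proj r) = sin (2 * pi * r).
Proof.
have [k hk] := repr_circle_proj r.
by rewrite /csin hk mulrDr (cos_sin_int k _).2.
Qed.

Lemma ccosD x y : ccos (x + y) = ccos x * ccos y - csin x * csin y.
Proof.
have [r <-] := circle_proj_surj x; have [s <-] := circle_proj_surj y.
by rewrite -circle_projD !ccosE !csinE mulrDr cosD.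
Qed.

Lemma csinD x y : csin (x + y) = csin x * ccos y + ccos x * csin y.
Proof.
have [r <-] := circle_proj_surj x; have [s <-] := circle_proj_surj y.
by rewrite -circle_projD !ccosE !csinE mulrDr sinD.
Qed.

Lemma ccosN x : ccos (- x) = ccos x.
Proof.
by have [r <-] := circle_proj_surj x; rewrite -circle_projN !ccosE mulrN cosN.
Qed.

Lemma csinN x : csin (- x) = - csin x.
Proof.
by have [r <-] := circle_proj_surj x; rewrite -circle_projN !csinE mulrN sinN.
Qed.

Lemma ccosB x y : ccos (x - y) = ccos x * ccos y + csin x * csin y.
Proof. by rewrite ccosD ccosN csinN mulrN opprK. Qed.

Lemma circle_proj0 : circle_proj 0 = 0 :> circle R.
Proof. by apply: (addrI (circle_proj 0)); rewrite -circle_projD !addr0. Qed.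

Lemma ccos0 : ccos 0 = 1.
Proof. by rewrite -circle_proj0 ccosE mulr0 cos0. Qed.

Lemma ccos2Dcsin2 x : ccos x ^+ 2 + csin x ^+ 2 = 1.
Proof. exact: cos2Dsin2. Qed.

Lemma ccos_norm_le1 x : `|ccos x| <= 1.
Proof. exact: cos_max. Qed.

Lemma csin_norm_le1 x : `|csin x| <= 1.
Proof. exact: sin_max. Qed.

Lemma ccos_le1 x : ccos x <= 1.
Proof. exact: cos_le1. Qed.

Lemma ccosM x y : ccos x * ccos y = (ccos (x + y) + ccos (x - y)) / 2.
Proof. by rewrite ccosB ccosD; field. Qed.

Lemma csinM x y : csin x * csin y = (ccos (x - y) - ccos (x + y)) / 2.
Proof. by rewrite ccosB ccosD; field. Qed.

(** The infimum defining the norm is attained at the representative nearest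
    to 0. *)
Lemma circle_norm_attained x :
  exists r, [/\ circle_proj r = x, `|r| = circle_norm x & `|r| <= 2^-1].
Proof.
have [s <-] := circle_proj_surj x.
pose r := s - (Num.floor (s + 2^-1))%:~R.
have rs : circle_proj r = circle_proj s.
  by apply/circle_projE; rewrite /r addrAC subrr add0r rpredN intr_int.
have r2 : `|r| <= 2^-1.
  have := floor_le (s + 2^-1); have := ltW (floorD1_gt (s + 2^-1)).
  by rewrite intrD ler_norml /r; lra.
exists r; split => //; rewrite -rs; apply/eqP; rewrite eq_le circle_norm_le andbT.
apply: lb_le_inf; first by case: (circle_norm_has_inf (circle_proj r)).
move=> _ [t /= /circle_projE/intrP[k hk] <-].
have [k0|k0] := eqVneq k 0.
  by rewrite k0 in hk; rewrite (_ : t = r)//; apply/eqP; rewrite -subr_eq0 hk.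
have k1 : (1 : R) <= `|k%:~R|.
  by rewrite -intr_norm (_ : 1 = 1%:~R)// ler_int -gtz0_ge1 normr_gt0.
have : `|t - r| <= `|t| + `|r| by exact: ler_normB.
by rewrite hk; lra.
Qed.

Lemma circle_norm_proj r : `|r| <= 2^-1 -> circle_norm (circle_proj r) = `|r|.
Proof.
move=> r2; apply/eqP; rewrite eq_le circle_norm_le/=.
have [s [/circle_projE/intrP[k hk] <- s2]] := circle_norm_attained (circle_proj r).
have [k0|k0] := eqVneq k 0.
  by rewrite k0 in hk; rewrite (_ : s = r)//; apply/eqP; rewrite -subr_eq0 hk.
have k1 : (1 : R) <= `|k%:~R|.
  by rewrite -intr_norm (_ : 1 = 1%:~R)// ler_int -gtz0_ge1 normr_gt0.
have : `|s - r| <= `|s| + `|r| by exact: ler_normB.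
by rewrite hk; lra.
Qed.

Lemma ccos_gap (e : R) : 0 < e -> e <= 2^-1 ->
  0 < 1 - cos (2 * pi * e) /\
  forall x, e <= circle_norm x -> 1 - cos (2 * pi * e) <= 1 - ccos x.
Proof.
move=> e0 e2; have pi0 := pi_gt0 R.
have itv r : 0 <= r -> r <= 2^-1 -> 2 * pi * r \in `[0, pi].
  move=> r0 r2; rewrite in_itv/=; apply/andP; split.
    by rewrite !mulr_ge0// ltW.
  rewrite mulrAC -[leRHS]mul1r ler_pM2r//; lra.
split.
  have := @ltr_cos R 0 (2 * pi * e); rewrite cos0 subr_gt0 => ->.
  - by rewrite !mulr_gt0.
  - by rewrite in_itv/= lexx ltW.
  - by rewrite itv// ltW.
move=> x ex; have [r [rx rn r2]] := circle_norm_attained x.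
rewrite lerD2l lerN2 -rx ccosE -[leLHS]cos_norm normrM.
rewrite (ger0_norm (mulr_ge0 (ler0n R 2) (ltW pi0))) rn leNgt ltr_cos.
- by rewrite -leNgt ler_pM2l// mulr_gt0.
- by rewrite itv ?circle_norm_ge0// -rn.
- by rewrite itv// ltW.
Qed.

End characters.

(** * Averages of sequences *)

Section averages.
Context {R : realType}.
Implicit Types (u v : nat -> R) (N : nat).

Definition avg N u : R := N%:R^-1 * \sum_(l < N) u l.

Lemma avg_le N u v : (forall l, (l < N)%N -> u l <= v l) -> avg N u <= avg N v.
Proof.
by move=> uv; rewrite ler_wpM2l ?invr_ge0// ler_sum// => l _; exact: uv.
Qed.

Lemma eq_avg N u v : (forall l, (l < N)%N -> u l = v l) -> avg N u = avg N v.
Proof. by move=> uv; congr (_ * _); apply: eq_bigr => l _; exact: uv. Qed.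

Lemma avg_cst N (a : R) : (0 < N)%N -> avg N (fun=> a) = a.
Proof.
move=> N0; rewrite /avg sumr_const card_ord -[a *+ N]mulr_natl mulrA mulVf ?mul1r//.
by rewrite pnatr_eq0 -lt0n.
Qed.

Lemma sumr_ord_cst N (a : R) : \sum_(l < N) a = N%:R * a.
Proof. by rewrite sumr_const card_ord mulr_natl. Qed.

Lemma avgD N u v : avg N (fun l => u l + v l) = avg N u + avg N v.
Proof. by rewrite /avg big_split mulrDr. Qed.

Lemma avgZ N (a : R) u : avg N (fun l => a * u l) = a * avg N u.
Proof. by rewrite /avg -mulr_sumr mulrCA. Qed.

Lemma avgB N u v : avg N (fun l => u l - v l) = avg N u - avg N v.
Proof. by rewrite /avg sumrB mulrBr. Qed.

Lemma avg_sum N (I : Type) (s : seq I) (f : I -> nat -> R) :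
  avg N (fun l => \sum_(i <- s) f i l) = \sum_(i <- s) avg N (f i).
Proof. by rewrite /avg exchange_big/= mulr_sumr. Qed.

Lemma avg_norm_le N u (b : R) : 0 <= b ->
  (forall l, (l < N)%N -> `|u l| <= b) -> `|avg N u| <= b.
Proof.
move=> b0 ub; have [->|N0] := posnP N.
  by rewrite /avg big_ord0 mulr0 normr0.
rewrite /avg normrM ger0_norm ?invr_ge0// -[leRHS](avg_cst b N0).
rewrite ler_wpM2l ?invr_ge0// (le_trans (ler_norm_sum _ _ _))//.
by rewrite ler_sum// => l _; exact: ub.
Qed.

Lemma sqr_avg_le N u : avg N u ^+ 2 <= avg N (fun l => u l ^+ 2).
Proof.
have [->|N0] := posnP N; first by rewrite /avg !big_ord0 !mulr0 expr0n.
set a := avg N u.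
have : 0 <= avg N (fun l => (u l - a) ^+ 2).
  by rewrite mulr_ge0 ?invr_ge0// sumr_ge0// => l _; rewrite sqr_ge0.
rewrite (@eq_avg _ _ (fun l => u l ^+ 2 + ((- 2 * a) * u l + a ^+ 2))); last first.
  by move=> l _; ring.
rewrite avgD avgD avgZ avg_cst// -/a.
by rewrite (_ : - 2 * a * a = - 2 * a ^+ 2); [lra|ring].
Qed.

Lemma avg_shift N u (i : nat) (b : R) : 0 <= b -> (forall l, `|u l| <= b) ->
  `|avg N (fun l => u (l + i)%N) - avg N u| <= 2 * i%:R * b / N%:R.
Proof.
move=> b0 ub; have [->|N0] := posnP N.
  by rewrite /avg !big_ord0 !mulr0 subrr normr0 invr0 mulr0.
rewrite /avg -mulrBr normrM ger0_norm ?invr_ge0// mulrC ler_wpM2r ?invr_ge0//.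
elim: i => [|i IH].
  rewrite [X in X - _](eq_bigr (fun l : 'I_N => u l)) => [|l _].
    by rewrite subrr normr0 mulr0 mul0r.
  by rewrite addn0.
have shift1 : \sum_(l < N) u (l + i.+1)%N =
    \sum_(l < N) u (l + i)%N + (u (N + i)%N - u i).
  case: N N0 {IH} => // N _.
  rewrite [LHS]big_ord_recr [in RHS]big_ord_recl/=.
  rewrite (eq_bigr (fun l : 'I_N => u (bump 0 l + i)%N)); last first.
    by move=> l _; congr u; rewrite /bump; lia.
  rewrite add0n; have -> : (N + i.+1 = N.+1 + i)%N by lia.
  by ring.
rewrite shift1 addrAC (le_trans (ler_normD _ _))//.
rewrite -[i.+1]addn1 natrD; have := ler_normB (u (N + i)%N) (u i).
by have := ub (N + i)%N; have := ub i; lra.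
Qed.

End averages.

(** * The Fejer kernel *)

Section fejer.
Context {R : realType}.
Implicit Types (t z : circle R) (K N : nat).

Definition fejer K z : R := K%:R^-1 *
  ((\sum_(j < K) ccos (z *+ j)) ^+ 2 + (\sum_(j < K) csin (z *+ j)) ^+ 2).

Lemma fejer_ge0 K z : 0 <= fejer K z.
Proof. by rewrite mulr_ge0 ?invr_ge0// addr_ge0 ?sqr_ge0. Qed.

Lemma fejerE K z : fejer K z =
  K%:R^-1 * \sum_(j < K) \sum_(k < K) ccos (z *+ j - z *+ k).
Proof.
congr (_ * _); rewrite !expr2 !big_distrlr -big_split; apply: eq_bigr => j _.
by rewrite -big_split; apply: eq_bigr => k _; rewrite ccosB.
Qed.

(** Multiplied by [1 - e(z)], the geometric sum of the [e(j z)] telescopes. *)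
Lemma fejer_le K z : (1 - ccos z) * fejer K z <= 2 / K%:R.
Proof.
rewrite mulrCA mulrC ler_wpM2r ?invr_ge0//.
set A := \sum_(j < K) ccos (z *+ j); set B := \sum_(j < K) csin (z *+ j).
have hA : (1 - ccos z) * A + csin z * B = 1 - ccos (z *+ K).
  rewrite /A /B; elim: (K) => [|m IH].
    by rewrite !big_ord0 mulr0n ccos0; ring.
  rewrite !big_ord_recr/= !mulrDr addrACA IH mulrS ccosD; ring.
have hB : (1 - ccos z) * B - csin z * A = - csin (z *+ K).
  rewrite /A /B; elim: (K) => [|m IH].
    have := ccos2Dcsin2 (0 : circle R); rewrite ccos0 => /eqP.
    rewrite expr1n -subr_eq0 addrAC subrr add0r sqrf_eq0 => /eqP s0.
    by rewrite !big_ord0 mulr0n s0; ring.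
  rewrite !big_ord_recr/= !mulrDr opprD addrACA IH mulrS csinD; ring.
have hz := ccos2Dcsin2 z; have hK := ccos2Dcsin2 (z *+ K).
have e : 2 * ((1 - ccos z) * (A ^+ 2 + B ^+ 2)) = 2 * (1 - ccos (z *+ K)).
  transitivity ((1 - ccos (z *+ K)) ^+ 2 + (- csin (z *+ K)) ^+ 2).
    rewrite -hA -hB.
    have -> : 2 * ((1 - ccos z) * (A ^+ 2 + B ^+ 2)) =
      (1 - 2 * ccos z + (ccos z ^+ 2 + csin z ^+ 2)) * (A ^+ 2 + B ^+ 2).
      by rewrite hz; ring.
    by ring.
  by rewrite sqrrN; move: hK; lra.
have : - 1 <= ccos (z *+ K) by exact: cos_geN1.
by move: e; lra.
Qed.

(** The hypotheses say that the empirical measure of [w] has, up to frequency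
    [K], the Fourier coefficients of a combination of the Dirac mass at 0 and
    of the Haar measure. Testing it against the Fejer kernel centred at a
    point [t] away from 0 and from all the [w l] shows that the Haar part
    nearly vanishes. *)
Lemma one_sub_avg_ccos_le N K (w : nat -> circle R) t (kap tau : R) :
  (0 < N)%N -> (0 < K)%N -> 0 < kap -> 0 <= tau -> kap <= 1 - ccos t ->
  (forall l, (l < N)%N -> kap <= 1 - ccos (w l - t)) ->
  (forall d, (0 < d < K)%N ->
    `|avg N (fun l => ccos (w l *+ d)) - avg N (fun l => ccos (w l))| <= tau /\
    `|avg N (fun l => csin (w l *+ d))| <= tau) ->
  1 - avg N (fun l => ccos (w l)) <= 4 / (K%:R * kap) + 2 * K%:R * tau.
Proof.
move=> N0 K0 kap0 tau0 tkap wkap hw.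
set C := avg N (fun l => ccos (w l)).
have KR0 : (0 : R) < K%:R by rewrite ltr0n.
have far z : kap <= 1 - ccos z -> fejer K z <= 2 / (K%:R * kap).
  move=> zk; rewrite -(ler_pM2l kap0) (le_trans (ler_wpM2r (fejer_ge0 K z) zk))//.
  have -> : kap * (2 / (K%:R * kap)) = 2 / K%:R by field; rewrite !gt_eqF.
  exact: fejer_le.
have up : avg N (fun l => fejer K (w l - t)) <= 2 / (K%:R * kap).
  rewrite -[leRHS](avg_cst _ N0); apply: avg_le => l lN; exact: far (wkap l lN).
have term (j k : 'I_K) :
    C * ccos (t *+ j - t *+ k) + ((1 - C) * (j == k)%:R - 2 * tau) <=
    avg N (fun l => ccos ((w l - t) *+ j - (w l - t) *+ k)).
  have [->|jk] := eqVneq j k.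
    rewrite subrr ccos0 (@eq_avg _ _ _ (fun=> 1)) => [|l _]; last first.
      by rewrite subrr ccos0.
    by rewrite avg_cst//= !mulr1; move: tau0; lra.
  pose d := ((j - k) + (k - j))%N.
  have dK : (0 < d < K)%N.
    by have := ltn_ord j; have := ltn_ord k; move: jk; rewrite -val_eqE/= /d; lia.
  have ed z : ccos (z *+ j - z *+ k) = ccos (z *+ d).
    have [kj|kj] := leqP k j.
      by rewrite -mulrnBr// /d; congr (ccos (_ *+ _)); lia.
    rewrite -ccosN opprB -mulrnBr ?(ltnW kj)// /d.
    by congr (ccos (_ *+ _)); lia.
  rewrite mulr0 sub0r ed (@eq_avg _ _ _ (fun l =>
    ccos (t *+ d) * ccos (w l *+ d) + csin (t *+ d) * csin (w l *+ d))); last first.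
    by move=> l _; rewrite ed mulrnBl ccosB; ring.
  rewrite avgD !avgZ; have [hc hs] := hw _ dK.
  have h1 : `|ccos (t *+ d) * (avg N (fun l => ccos (w l *+ d)) - C)| <= tau.
    by rewrite normrM -[leRHS]mul1r ler_pM// ccos_norm_le1.
  have h2 : `|csin (t *+ d) * avg N (fun l => csin (w l *+ d))| <= tau.
    by rewrite normrM -[leRHS]mul1r ler_pM// csin_norm_le1.
  move: h1 h2; rewrite mulrBr [C * _]mulrC !ler_norml; lra.
have low : C * fejer K t + (1 - C) - 2 * K%:R * tau <=
    avg N (fun l => fejer K (w l - t)).
  rewrite (@eq_avg _ _ _ (fun l => K%:R^-1 * \sum_(j < K) \sum_(k < K)
     ccos ((w l - t) *+ j - (w l - t) *+ k))); last by move=> l _; exact: fejerE.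
  rewrite avgZ avg_sum.
  under eq_bigr do rewrite avg_sum.
  rewrite fejerE [in leLHS]mulrCA.
  have -> : K%:R^-1 * (C * \sum_(j < K) \sum_(k < K) ccos (t *+ j - t *+ k)) +
      (1 - C) - 2 * K%:R * tau = K%:R^-1 * \sum_(j < K) \sum_(k < K)
        (C * ccos (t *+ j - t *+ k) + ((1 - C) * (j == k)%:R - 2 * tau)).
    under [in RHS]eq_bigr do rewrite big_split/= sumrB -!mulr_sumr.
    rewrite big_split/= sumrB -!mulr_sumr.
    have -> : \sum_(j < K) \sum_(k < K) (j == k)%:R = K%:R :> R.
      rewrite -[in RHS](card_ord K) -sumr_const; apply: eq_bigr => j _.
      rewrite (bigD1 j)//= eqxx big1 ?addr0// => k.
      by rewrite eq_sym => /negPf ->.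
    by rewrite !sumr_ord_cst; field; rewrite gt_eqF.
  rewrite ler_wpM2l ?invr_ge0// ler_sum// => j _; rewrite ler_sum// => k _.
have C1 : `|C| <= 1.
  by apply: avg_norm_le => // l _; exact: ccos_norm_le1.
have : `|C * fejer K t| <= 2 / (K%:R * kap).
  by rewrite normrM (ger0_norm (fejer_ge0 K t)) -[leRHS]mul1r ler_pM ?far ?fejer_ge0.
rewrite ler_norml => /andP[h _].
have -> : 4 / (K%:R * kap) = 2 / (K%:R * kap) + 2 / (K%:R * kap) :> R.
  by rewrite -mulrDl; congr (_ / _); ring.
lra.
Qed.

End fejer.

(** * Almost invariance along Folner sets *)

Lemma sum_fset_dilate (R : realType) (F : {fset nat}) (q : nat) (G : nat -> R) :
  (0 < q)%N -> (forall n, `|G n| <= 1) ->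
  `|\sum_(n <- F) G (n * q)%N - \sum_(n <- F) G n| <=
  #|` fset_symdiff (fset_scale q F) F|%:R.
Proof.
move=> q0 G1; set S := fset_scale q F.
have -> : \sum_(n <- F) G (n * q)%N = \sum_(n <- S) G n.
  rewrite /S /fset_scale big_imfset/=.
    by apply: eq_bigr => n _; rewrite mulnC.
  by move=> a b _ _ /eqP; rewrite eqn_pmul2l// => /eqP.
have split (A B : {fset nat}) : \sum_(n <- A) G n =
    \sum_(n <- (A `&` B)%fset) G n + \sum_(n <- (A `\` B)%fset) G n.
  rewrite (big_fsetID _ (mem B)); congr (_ + _); apply: eq_fbigl => n;
    by rewrite !inE 1?andbC.
rewrite (split S F) (split F S) fsetIC opprD addrACA subrr add0r.
have bound (A : {fset nat}) : `|\sum_(n <- A) G n| <= #|` A|%:R.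
  rewrite (le_trans (ler_norm_sum _ _ _))//.
  apply: (@le_trans _ _ (\sum_(n <- A) 1)); first exact: ler_sum.
  by rewrite big_const_seq count_predT iter_addr_0.
rewrite (le_trans (ler_normB _ _))//.
rewrite (le_trans (lerD (bound _) (bound _)))// -natrD ler_nat.
rewrite /fset_symdiff cardfsU [X in (_ - X)%N](_ : _ = 0%N) ?subn0//.
apply/eqP; rewrite cardfs_eq0; apply/eqP/fsetP => n; rewrite !inE.
by case: (n \in S); case: (n \in F).
Qed.

Section decorrelation.
Context {R : realType} (p N : nat) (F : {fset nat}) (z : nat -> circle R).
Implicit Types (g h : circle R -> R) (a b d q i j : nat).

Local Notation nF := (#|` F|%:R : R).

Definition orbit_avg n g : R := avg N (fun l => g (z l *+ n)).

Definition total_avg g : R := \sum_(n <- F) orbit_avg n g.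

Lemma sum_fset_cst (r : R) : \sum_(n <- F) r = r * nF.
Proof. by rewrite big_const_seq count_predT iter_addr_0 mulr_natr. Qed.

(** Averaging [g] over its images under [M] powers of the same dilation
    changes the orbit averages little, and Cauchy-Schwarz turns the mean
    square into correlations: pairwise decorrelation of these images is what
    makes the mean square small. *)
Lemma sum_sqr_orbit_avg_le K M g (b Gam : R) :
  (forall l, z l.+1 = z l *+ p) -> (0 < M)%N -> 0 <= b ->
  0 <= Gam -> (forall x, `|g x| <= b) ->
  (forall i j, (i < M)%N -> (j < M)%N -> i != j ->
    total_avg (fun x => g (x *+ (p ^ K) ^ i) * g (x *+ (p ^ K) ^ j)) <=
    Gam * nF) ->
  \sum_(n <- F) orbit_avg n g ^+ 2 <=
  (2 * (b ^+ 2 / M%:R + Gam) + 2 * (2 * (K * M)%:R * b / N%:R) ^+ 2) * nF.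
Proof.
move=> zS M0 b0 Gam0 gb corr.
have MR0 : (0 : R) < M%:R by rewrite ltr0n.
(* Time shifts of the orbit are dilations by powers of [p]. *)
have zD l i : z (l + i)%N = z l *+ p ^ i.
  elim: i => [|i IH]; first by rewrite addn0 expn0 mulr1n.
  by rewrite addnS zS IH expnSr mulrnA.
set om := 2 * (K * M)%:R * b / N%:R.
pose Mg x := avg M (fun i => g (x *+ (p ^ K) ^ i)).
have shift n : `|orbit_avg n Mg - orbit_avg n g| <= om.
  have -> : orbit_avg n Mg - orbit_avg n g = avg M (fun i =>
      avg N (fun l => g (z (l + K * i)%N *+ n)) - avg N (fun l => g (z l *+ n))).
    rewrite avgB avg_cst//; congr (_ - _); rewrite /orbit_avg /Mg /avg.
    rewrite -mulr_sumr exchange_big/= -mulr_sumr mulrCA; congr (_ * (_ * _)).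
    apply: eq_bigr => i _; apply: eq_bigr => l _.
    by rewrite zD -!mulrnA mulnC expnM.
  have om0 : 0 <= om by rewrite !mulr_ge0 ?invr_ge0.
  apply: avg_norm_le => // i iM.
  rewrite (le_trans (@avg_shift _ N (fun l => g (z l *+ n)) (K * i) b b0 _))//.
  rewrite ler_wpM2r ?invr_ge0// ler_wpM2r// ler_wpM2l// ler_nat.
  by rewrite leq_mul// ltnW.
have Mg2 x : Mg x ^+ 2 = M%:R^-1 ^+ 2 * \sum_(i < M) \sum_(j < M)
    g (x *+ (p ^ K) ^ i) * g (x *+ (p ^ K) ^ j).
  by rewrite /Mg /avg exprMn [in LHS]expr2 [in LHS]expr2 big_distrlr expr2.
have MgF : total_avg (fun x => Mg x ^+ 2) <= (b ^+ 2 / M%:R + Gam) * nF.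
  have -> : total_avg (fun x => Mg x ^+ 2) = M%:R^-1 ^+ 2 *
      \sum_(i < M) \sum_(j < M)
        total_avg (fun x => g (x *+ (p ^ K) ^ i) * g (x *+ (p ^ K) ^ j)).
    rewrite /total_avg /orbit_avg.
    under eq_bigr => n _.
      rewrite (@eq_avg _ _ _ (fun l => M%:R^-1 ^+ 2 * \sum_(i < M) \sum_(j < M)
        g (z l *+ n *+ (p ^ K) ^ i) * g (z l *+ n *+ (p ^ K) ^ j))); last first.
        by move=> l _; exact: Mg2.
      rewrite avgZ avg_sum.
      under eq_bigr do rewrite avg_sum.
      over.
    rewrite -mulr_sumr exchange_big/=; congr (_ * _).
    by apply: eq_bigr => i _; rewrite exchange_big.
  have -> : (b ^+ 2 / M%:R + Gam) * nF = M%:R^-1 ^+ 2 * \sum_(i < M) \sum_(j < M)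
      ((i == j)%:R * b ^+ 2 + Gam) * nF.
    under eq_bigr do rewrite -mulr_suml big_split/= -mulr_suml.
    rewrite -mulr_suml big_split/= -mulr_suml.
    have -> : \sum_(j < M) \sum_(i < M) (j == i)%:R = M%:R :> R.
      rewrite -[in RHS](card_ord M) -sumr_const; apply: eq_bigr => j _.
      rewrite (bigD1 j)//= eqxx big1 ?addr0// => k.
      by rewrite eq_sym => /negPf ->.
    by rewrite !sumr_ord_cst; field; rewrite gt_eqF.
  rewrite ler_wpM2l ?sqr_ge0// ler_sum// => i _; rewrite ler_sum// => j _.
  have [->|ij] := eqVneq i j; last by rewrite mul0r add0r corr.
  rewrite mul1r; apply: (@le_trans _ _ (b ^+ 2 * nF)); last first.
    by rewrite ler_wpM2r// lerDl.
  rewrite -sum_fset_cst; apply: ler_sum => n _.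
  rewrite (le_trans (ler_norm _))//; apply: avg_norm_le; rewrite ?sqr_ge0//.
  by move=> l _; rewrite normrM expr2 ler_pM.
apply: (@le_trans _ _
    (\sum_(n <- F) (2 * orbit_avg n (fun x => Mg x ^+ 2) + 2 * om ^+ 2))).
  apply: ler_sum => n _.
  have := sqr_avg_le N (fun l => Mg (z l *+ n)).
  rewrite -/(orbit_avg n Mg) -/(orbit_avg n (fun x => Mg x ^+ 2)).
  have : (orbit_avg n Mg - orbit_avg n g) ^+ 2 <= om ^+ 2.
    by rewrite -[leLHS]real_normK ?num_real// ler_pXn2r ?nnegrE// (le_trans _ (shift n)).
  (* This square gives [x ^ 2 <= 2 y ^ 2 + 2 (x - y) ^ 2]. *)
  have : 0 <= (2 * orbit_avg n Mg - orbit_avg n g) ^+ 2 by rewrite sqr_ge0.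
  by rewrite !expr2; nra.
rewrite big_split/= -mulr_sumr sum_fset_cst [leRHS]mulrDl lerD2r -mulrA ler_pM2l//.
Qed.

(** Combinations of the Dirac mass at 0 and of the Haar measure have equal
    cosine coefficients at all nonzero frequencies. Near invariance under the
    dilations up to [Q] forces the same, approximately, on the average over
    [F] of the orbit measures. *)
Definition flat_spectrum Q (gam : R) := forall q, (0 < q <= Q)%N ->
  `|total_avg (fun x => ccos (x *+ q)) - total_avg ccos| <= gam * nF.

Lemma total_avgD g h :
  total_avg (fun x => g x + h x) = total_avg g + total_avg h.
Proof.
by rewrite /total_avg -big_split; apply: eq_bigr => n _; rewrite /orbit_avg avgD.
Qed.

Lemma total_avgB g h :
  total_avg (fun x => g x - h x) = total_avg g - total_avg h.
Proof.
by rewrite /total_avg -sumrB; apply: eq_bigr => n _; rewrite /orbit_avg avgB.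
Qed.

Lemma total_avgZ (r : R) g : total_avg (fun x => r * g x) = r * total_avg g.
Proof.
by rewrite /total_avg mulr_sumr; apply: eq_bigr => n _; rewrite /orbit_avg avgZ.
Qed.

Lemma eq_total_avg g h : (forall x, g x = h x) -> total_avg g = total_avg h.
Proof. by move=> /funext ->. Qed.

Lemma ccos_mulrn_dist x a b :
  ccos (x *+ a - x *+ b) = ccos (x *+ ((a - b) + (b - a))) :> R.
Proof.
have [ba|ab] := leqP b a.
  by rewrite -mulrnBr//; congr (ccos (_ *+ _)); lia.
rewrite -ccosN opprB -mulrnBr ?(ltnW ab)//.
by congr (ccos (_ *+ _)); lia.
Qed.

Lemma total_avg_ccosM Q (gam : R) a b : flat_spectrum Q gam ->
  a != b -> (a + b <= Q)%N ->
  `|total_avg (fun x => ccos (x *+ a) * ccos (x *+ b)) - total_avg ccos|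
  <= gam * nF.
Proof.
move=> flat ab abQ.
rewrite (@eq_total_avg _ (fun x => 2^-1 * (ccos (x *+ (a + b)) +
  ccos (x *+ ((a - b) + (b - a)))))); last first.
  by move=> x; rewrite ccosM -mulrnDr ccos_mulrn_dist mulrC.
rewrite total_avgZ total_avgD.
have /flat : (0 < a + b <= Q)%N by lia.
have /flat : (0 < (a - b) + (b - a) <= Q)%N by lia.
by rewrite !ler_norml; lra.
Qed.

Lemma total_avg_csinM Q (gam : R) a b : flat_spectrum Q gam ->
  a != b -> (a + b <= Q)%N ->
  `|total_avg (fun x => csin (x *+ a) * csin (x *+ b))| <= gam * nF.
Proof.
move=> flat ab abQ.
rewrite (@eq_total_avg _ (fun x => 2^-1 * (ccos (x *+ ((a - b) + (b - a))) -
  ccos (x *+ (a + b))))); last first.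
  by move=> x; rewrite csinM -mulrnDr ccos_mulrn_dist mulrC.
rewrite total_avgZ total_avgB.
have /flat : (0 < a + b <= Q)%N by lia.
have /flat : (0 < (a - b) + (b - a) <= Q)%N by lia.
by rewrite !ler_norml; lra.
Qed.

(** The orbit averages of [sin d x] and of [cos d x - cos x] are small in mean
    square. Both functions vanish at 0, so the constant part of the flat
    spectrum cancels out of their correlations. *)
Lemma sum_sqr_fourier_le K M d (gam : R) :
  (forall l, z l.+1 = z l *+ p) -> (0 < M)%N -> 0 <= gam ->
  (0 < d < p ^ K)%N -> flat_spectrum (2 * (p ^ K) ^ M.+1) gam ->
  let B := (2 * (4 / M%:R + 4 * gam) + 2 * (4 * (K * M)%:R / N%:R) ^+ 2) * nF in
  \sum_(n <- F) orbit_avg n (fun x => csin (x *+ d)) ^+ 2 <= B /\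
  \sum_(n <- F) (orbit_avg n (fun x => ccos (x *+ d)) - orbit_avg n ccos) ^+ 2
    <= B.
Proof.
move=> zS M0 gam0 dP flat B.
set P := (p ^ K)%N in dP flat.
have P1 : (0 < P)%N by lia.
have Pi i : (0 < P ^ i)%N by rewrite expn_gt0 P1.
have powM i e : (i < M)%N -> (e <= P)%N -> (P ^ i * e <= P ^ M.+1)%N.
  move=> iM eP; rewrite expnSr leq_mul// leq_pexp2l// ltnW//.
(* No frequency of one image of [cos d x - cos x] meets a frequency of
   another one: this is why the step is a power of [p] exceeding [d]. *)
have dist i j : i != j -> (P ^ i * d)%N != (P ^ j)%N.
  move=> ij; apply/eqP => e.
  have [ltij|ltji|/eqP] := ltngtP i j; last by rewrite (negPf ij).
    have : (P ^ i.+1 <= P ^ j)%N by rewrite leq_pexp2l.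
    by rewrite -e expnSr leq_pmul2l// leqNgt; case/andP: dP => _ ->.
  have P2 : (1 < P)%N.
    have [//|P2] := ltnP 1 P; have e1 : P = 1%N by lia.
    by move: dP; rewrite e1; lia.
  have : (P ^ j < P ^ i)%N by rewrite ltn_exp2l.
  by rewrite -e; have := Pi i; nia.
have distP i j : i != j -> (P ^ i)%N != (P ^ j)%N.
  move=> ij; have [P2|P2] := ltnP 1 P; first by rewrite eqn_exp2l.
  have e1 : P = 1%N by lia.
  by move: dP; rewrite e1; lia.
have dle : (d <= P)%N by lia.
have eB : B = (2 * (2 ^+ 2 / M%:R + 4 * gam) +
    2 * (2 * (K * M)%:R * 2 / N%:R) ^+ 2) * nF.
  rewrite /B; congr ((2 * (_ / _ + _) + 2 * (_ / _) ^+ 2) * _); ring.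
rewrite eB; split.
  apply: sum_sqr_orbit_avg_le => //; first by rewrite mulr_ge0.
    by move=> x; rewrite (le_trans (csin_norm_le1 _))// ler1n.
  move=> i j iM jM ij; rewrite -/P.
  rewrite (@eq_total_avg _ (fun x => csin (x *+ (P ^ i * d)) *
    csin (x *+ (P ^ j * d)))); last by move=> x; rewrite -!mulrnA.
  rewrite (le_trans (ler_norm _))//.
  rewrite (le_trans (total_avg_csinM flat _ _))//.
  - by rewrite eqn_pmul2r ?distP//; case/andP: dP.
  - by have := powM _ _ iM dle; have := powM _ _ jM dle; lia.
  - by rewrite ler_wpM2r// ler_peMl// ler1n.
rewrite (eq_bigr (fun n => orbit_avg n (fun x => ccos (x *+ d) - ccos x) ^+ 2));
  last by move=> n _; rewrite /orbit_avg avgB.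
apply: sum_sqr_orbit_avg_le => //; first by rewrite mulr_ge0.
  move=> x; rewrite (le_trans (ler_normB _ _))//.
  by have := ccos_norm_le1 (x *+ d); have := ccos_norm_le1 x; lra.
move=> i j iM jM ij; rewrite -/P.
rewrite (@eq_total_avg _ (fun x =>
  (ccos (x *+ (P ^ i * d)) * ccos (x *+ (P ^ j * d)) -
   ccos (x *+ (P ^ i * d)) * ccos (x *+ (P ^ j))) -
  (ccos (x *+ (P ^ j * d)) * ccos (x *+ (P ^ i)) -
   ccos (x *+ (P ^ i)) * ccos (x *+ (P ^ j))))); last first.
  by move=> x; rewrite -!mulrnA; ring.
rewrite 3!total_avgB.
have hi := powM _ _ iM dle; have hj := powM _ _ jM dle.
have hi1 := powM _ _ iM P1; have hj1 := powM _ _ jM P1.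
have := @total_avg_ccosM _ _ (P ^ i * d) (P ^ j * d) flat.
rewrite eqn_pmul2r ?distP//; last by case/andP: dP.
move=> /(_ isT ltac:(lia)).
have := @total_avg_ccosM _ _ _ _ flat (dist _ _ ij) ltac:(lia).
have := @total_avg_ccosM _ _ (P ^ j * d) (P ^ i) flat
  ltac:(by apply: dist; rewrite eq_sym) ltac:(lia).
have := @total_avg_ccosM _ _ _ _ flat (distP _ _ ij) ltac:(lia).
by rewrite !ler_norml; lra.
Qed.

End decorrelation.

(** * Positive entropy keeps orbits away from 0 *)

Section entropy_witness.
Context {R : realType} {X : metricType R}.
Implicit Types (f : X -> X) (A : set X) (e h : R) (N : nat).

Lemma entropy_at_ge0 f A e : A !=set0 -> (0 <= entropy_at f A e)%E.
Proof.
move=> [x Ax]; apply: limf_esup_ge0 => [|N].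
  exact: (@filter_not_empty _ (\oo : set_system nat)).
rewrite mule_ge0 ?lee_fin ?invr_ge0// lne_ge0.
apply: ereal_sup_ubound; exists [fset x]%fset; last by rewrite cardfs1.
split=> [y /=|y z]; first by rewrite inE => /eqP ->.
by rewrite !inE => /eqP -> /eqP ->; rewrite eqxx.
Qed.

Lemma topological_entropy_gt0_separated f A :
  A !=set0 -> (0 < topological_entropy f A)%E ->
  exists e h, [/\ 0 < e, 0 < h & forall N0, exists N, (N0 <= N)%N /\
    exists2 E, Defs.separated f A N e E & expR (h * N%:R) < #|` E|%:R].
Proof.
move=> A0 entA.
have [e e0 ente] : exists2 e, 0 < e & (0 < entropy_at f A e)%E.
  apply: contrapT => no; move: entA.
  suff -> : topological_entropy f A = 0%E by rewrite ltxx.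
  apply: lim_near_cst; first exact: ereal_hausdorff.
  near=> e; apply/eqP; rewrite eq_le entropy_at_ge0// andbT leNgt.
  by apply/negP => h; apply: no; exists e.
have [h h0 hent] : exists2 h, 0 < h & (h%:E < entropy_at f A e)%E.
  case: (entropy_at f A e) ente => [r| |]//.
    by rewrite lte_fin => r0; exists (r / 2); rewrite ?lte_fin; lra.
  by exists 1 => //; rewrite ltry.
exists e, h; split => // N0.
have [N N0N hN] : exists2 N, (N0 + 1 <= N)%N &
    (h%:E < (N%:R^-1)%:E * lne (separation_number f A N e))%E.
  apply: contrapT => no; move: hent; rewrite ltNge => /negP; apply.
  apply: (@le_trans _ _ (ereal_sup ((fun N =>
    ((N%:R^-1)%:E * lne (separation_number f A N e))%E) @`
    [set N | (N0 + 1 <= N)%N]))).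
    apply: ereal_inf_lbound; exists [set N | (N0 + 1 <= N)%N] => //.
    by exists (N0 + 1)%N.
  apply: ge_ereal_sup => _ [N /= N0N <-]; rewrite leNgt; apply/negP => hN.
  by apply: no; exists N.
exists N; split; first lia.
have NR0 : (0 : R) < N%:R by rewrite ltr0n; lia.
have : ((expR (h * N%:R))%:E < separation_number f A N e)%E.
  move: hN; rewrite muleC lte_pdivlMr// -EFinM.
  case: (separation_number f A N e) => [r| |]//=; last by rewrite !ltry.
  case: ifPn => //; rewrite -ltNge => r0.
  by rewrite !lte_fin -ltr_expR lnK.
by move=> /ereal_sup_gt[_ [E sepE <-]]; rewrite lte_fin; exists E.
Unshelve. all: by end_near. Qed.

End entropy_witness.

Section coding.
Context {R : realType}.
Implicit Types (x y z d : circle R) (n p N m i : nat).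

(** If all the multiples of [d] by [n p^i] stay in a ball that is small
    compared with [1/p], then a multiple by [p] cannot wrap around the
    circle, so the bound [rho / n] propagates. *)
Lemma small_orbit p n N d (rho : R) : (0 < n)%N -> (p.+1)%:R * rho < 1 ->
  circle_norm d <= rho / n%:R ->
  (forall i, (i < N)%N -> circle_norm (d *+ (n * p ^ i)) <= rho) ->
  forall i, (i < N)%N -> circle_norm (d *+ p ^ i) <= rho / n%:R.
Proof.
move=> n0 prho d0 hd; have nR0 : (0 : R) < n%:R by rewrite ltr0n.
have projM r m : circle_proj r *+ m = circle_proj (r *+ m) :> circle R.
  elim: m => [|m IH]; first by rewrite !mulr0n circle_proj0.
  by rewrite !mulrS circle_projD IH.
elim=> [_|i IH iN]; first by rewrite expn0 mulr1n.
have [t [tE tn _]] := circle_norm_attained (d *+ p ^ i).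
have := IH (ltnW iN); rewrite -tn ler_pdivlMr// => tb.
have [s [sE sn _]] := circle_norm_attained (d *+ (n * p ^ i.+1)).
have := hd _ iN; rewrite -sn => sb.
have : circle_proj s = circle_proj (t *+ (n * p)) :> circle R.
  by rewrite sE -projM tE -mulrnA expnSr; congr (_ *+ _); lia.
move=> /circle_projE/intrP[k hk].
have etnp : `|t *+ (n * p)| = p%:R * (`|t| * n%:R).
  rewrite -[t *+ _]mulr_natr natrM !normrM !(ger0_norm (ler0n _ _)); ring.
have tnp : `|t *+ (n * p)| <= p%:R * rho by rewrite etnp ler_wpM2l.
have k0 : k = 0.
  apply/eqP; rewrite -normr_le0 -ltzD1 add0r -(ltr_int R) intr_norm -hk.
  rewrite (le_lt_trans _ prho)// (le_trans (ler_normB _ _))//.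
  by rewrite -[p.+1]addn1 natrD; lra.
have st : s = t *+ (n * p).
  by apply/eqP; rewrite -subr_eq0 hk k0.
rewrite expnSr mulrnA -tE projM (le_trans (circle_norm_le _))//.
rewrite ler_pdivlMr// (le_trans _ sb)// st etnp -[t *+ p]mulr_natr normrM.
by rewrite (ger0_norm (ler0n _ _)) -mulrA mulrCA.
Qed.

Lemma repr01 x : exists2 r : R, circle_proj r = x & 0 <= r < 1.
Proof.
have [s <-] := circle_proj_surj x; exists (s - (Num.floor s)%:~R).
  by apply/circle_projE; rewrite addrAC subrr add0r rpredN intr_int.
have := floor_le s; have := floorD1_gt s; rewrite intrD; lra.
Qed.

Lemma circle_cells m : (0 < m)%N -> exists cell : circle R -> 'I_m,
  forall x y, cell x = cell y -> circle_norm (x - y) <= m%:R^-1.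
Proof.
move=> m_gt0; have m0 : (0 : R) < m%:R by rewrite ltr0n.
have [r rP] := choice (fun x => let: ex_intro2 r a b := repr01 x in
  ex_intro (fun r => circle_proj r = x /\ 0 <= r < 1) r (conj a b)).
have tr x := @truncn_itv R (m%:R * r x)
  (mulr_ge0 (ltW m0) (proj1 (andP (rP x).2))).
have trm x : (Num.truncn (m%:R * r x) < m)%N.
  have /andP[h _] := tr x; have /andP[_ r1] := (rP x).2.
  by rewrite -(ltr_nat R) (le_lt_trans h)// -[ltRHS]mulr1 ltr_pM2l.
exists (fun x => Ordinal (trm x)) => x y /(congr1 val)/= exy.
rewrite -(rP x).1 -(rP y).1 -circle_projN -circle_projD.
rewrite (le_trans (circle_norm_le _))//.
rewrite -(ler_pM2l m0) mulfV ?gt_eqF// -[X in X * _]ger0_norm// -normrM mulrBr.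
have := tr x; have := tr y; rewrite -exy -[_.+1 in X in _ < X]addn1 natrD.
by rewrite ler_norml; lra.
Qed.

Lemma sum_inj_le (T : eqType) (C : finType) (s : seq T) (code : T -> C)
    (G : C -> R) : uniq s -> {in s &, injective code} -> (forall c, 0 <= G c) ->
  \sum_(x <- s) G (code x) <= \sum_c G c.
Proof.
move=> us inj G0; rewrite -(big_map code xpredT G) big_uniq; last first.
  by rewrite map_inj_in_uniq.
by rewrite [leRHS](bigID (mem (map code s)))/= lerDl sumr_ge0.
Qed.

Lemma sum_ffun_weight N m (a : R) :
  \sum_(w : {ffun 'I_N -> option 'I_m}) \prod_i (if w i is Some _ then a else 1)
  = (1 + m%:R * a) ^+ N.
Proof.
rewrite -(bigA_distr_bigA (fun _ o => if o is Some _ then a else 1)).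
rewrite prodr_const card_ord; congr (_ ^+ _).
rewrite (bigD1 None)//= (reindex_omap Some id); last by case.
rewrite (eq_bigl xpredT); last by move=> k; rewrite eqxx.
by rewrite sumr_const card_ord mulr_natl.
Qed.

(** Points whose orbits under [n p^i] are rarely far from 0 are coded by an
    arc of length [1 / (n L)] and by the arcs of length [1 / L] visited at
    the rare times when the orbit is far from 0. Giving weight
    [exp (- sig)] to such times and weight 1 to the others, the total weight
    of all codes is a product over the times, and each code used weighs at
    least [exp (- sig th N)]. *)
Lemma card_near0_orbits_le p n N L (E : seq (circle R)) (kap sig th : R) :
  (0 < n)%N -> (0 < L)%N -> p.+1%:R / L%:R < 1 :> R ->
  0 < kap -> 0 < sig ->
  (forall z, (2 * L%:R)^-1 <= circle_norm z -> kap <= 1 - ccos z) ->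
  uniq E ->
  {in E, forall x,
     \sum_(i < N) (1 - ccos (x *+ (n * p ^ i))) <= kap * th * N%:R} ->
  {in E &, forall x y, x != y ->
     L%:R^-1 < bowen_dist (times p) N x y} ->
  (size E)%:R <=
    (n * L)%:R * (1 + L%:R * expR (- sig)) ^+ N * expR (sig * th * N%:R).
Proof.
move=> n0 L0 pL kap0 sig0 hkap uE nearE sepE.
have LR0 : (0 : R) < L%:R by rewrite ltr0n.
have nR0 : (0 : R) < n%:R by rewrite ltr0n.
have [c1 hc1] := @circle_cells (n * L) ltac:(by rewrite muln_gt0 n0).
have [c2 hc2] := circle_cells L0.
(* Radius [1 / (2 L)] makes two near-0 points as close as two points of one
   arc, so that [None] is as informative as an arc. *)
pose letter z := if circle_norm z < (2 * L%:R)^-1 then None else Some (c2 z).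
pose word x := [ffun i : 'I_N => letter (x *+ (n * p ^ i))].
pose code x := (c1 x, word x).
have letter_close y z : letter y = letter z -> circle_norm (y - z) <= L%:R^-1.
  rewrite /letter; case: ifPn => [hy|_]; case: ifPn => //; [move=> hz _|by move=> _ [/hc2]].
  rewrite (le_trans (circle_norm_triangle _ _))// circle_normN.
  have -> : L%:R^-1 = (2 * L%:R)^-1 + (2 * L%:R)^-1 :> R.
    by field; rewrite gt_eqF.
  by rewrite lerD// ltW.
have inj : {in E &, injective code}.
  move=> x y xE yE [e1 /ffunP e2]; apply/eqP; apply: contraT => xy.
  have := sepE x y xE yE xy; rewrite ltNge => /negP[].
  apply: bigmax_le => [|i _]; first by rewrite invr_ge0.
  have iterE z k : iter k (times p) z = z *+ p ^ k.
    elim: k => [|k IH]; first by rewrite expn0 mulr1n.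
    by rewrite iterS IH /times -mulrnA expnSr.
  rewrite !iterE -[leLHS]/(circle_norm (x *+ p ^ i - y *+ p ^ i)) -mulrnBl.
  apply: (@le_trans _ _ (L%:R^-1 / n%:R)); last first.
    by rewrite ler_pdivrMr// ler_peMr ?invr_ge0// ler1n.
  apply: (@small_orbit p n N) => //.
    by rewrite (le_trans (hc1 _ _ e1))// natrM invfM mulrC.
  move=> j jN; rewrite mulrnBl; apply: letter_close.
  by have := e2 (Ordinal jN); rewrite !ffunE.
pose G (c : 'I_(n * L) * {ffun 'I_N -> option 'I_L}) : R :=
  \prod_i (if c.2 i is Some _ then expR (- sig) else 1).
have G0 c : 0 <= G c by apply: prodr_ge0 => i _; case: (c.2 i) => // _; exact: expR_ge0.
have sumG : \sum_c G c = (n * L)%:R * (1 + L%:R * expR (- sig)) ^+ N.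
  rewrite (eq_bigr (fun c => G (c.1, c.2))); last by case.
  rewrite -(pair_bigA _ (fun a b => G (a, b)))/=.
  rewrite (eq_bigr (fun=> (1 + L%:R * expR (- sig)) ^+ N)) => [|a _].
    by rewrite sumr_ord_cst.
  by rewrite -sum_ffun_weight.
have Gcode x : x \in E -> expR (- (sig * th * N%:R)) <= G (code x).
  move=> xE; apply: (@le_trans _ _
      (expR (\sum_(i < N) - (sig / kap * (1 - ccos (x *+ (n * p ^ i))))))).
    rewrite ler_expR sumrN lerN2 -mulr_sumr.
    have -> : sig * th * N%:R = sig / kap * (kap * th * N%:R).
      by field; rewrite gt_eqF.
    by rewrite ler_wpM2l ?nearE// divr_ge0 ?ltW.
  rewrite expR_sum; apply: ler_prod => i _; rewrite expR_ge0/= ffunE /letter.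
  have c1x := ccos_le1 (x *+ (n * p ^ i)).
  case: ifPn => [_|].
    by rewrite -[leRHS]expR0 ler_expR oppr_le0 mulr_ge0 ?divr_ge0 ?subr_ge0// ltW.
  rewrite -leNgt => /hkap h.
  by rewrite ler_expR lerN2 mulrAC ler_pdivlMr// ler_pM2l.
have := sum_inj_le uE inj G0; rewrite sumG => h.
rewrite -ler_pdivrMr ?expR_gt0// -expRN (le_trans _ h)//.
rewrite [leLHS](_ : _ = \sum_(x <- E) expR (- (sig * th * N%:R))); last first.
  by rewrite big_const_seq count_predT iter_addr_0 mulr_natl.
by rewrite !big_seq ler_sum.
Qed.

(** Were every orbit close to 0 most of the time after multiplication by some
    [n] in [F], the orbits up to time [N] would be too few to reach the
    growth rate given by the entropy. *)
Lemma entropy_gt0_orbit_avg p (Y : set (circle R)) : Y !=set0 ->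
  (0 < topological_entropy (@times R p) Y)%E ->
  exists2 eta : R, 0 < eta & forall (F : {fset nat}) N0,
    (forall n, n \in F -> (0 < n)%N) ->
    exists2 N, (N0 < N)%N & exists2 x, Y x &
      forall n, n \in F -> eta <= 1 - avg N (fun l => ccos (x *+ (n * p ^ l))).
Proof.
move=> Y0 /(topological_entropy_gt0_separated Y0)[e [h [e0 h0 sep]]].
(* [1 / L] is below both the separation scale and the scale at which a
   multiple by [p] could wrap around. *)
pose L := (Num.truncn (Num.max e^-1 p.+1%:R)).+1.
have LR0 : (0 : R) < L%:R by rewrite ltr0n.
have hL : Num.max e^-1 p.+1%:R < L%:R :> R by exact: truncnS_gt.
have Le : L%:R^-1 <= e.
  rewrite -[e]invrK lef_pV2 ?posrE ?invr_gt0// ltW//.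
  by rewrite (le_lt_trans _ hL)// le_max lexx.
have Lp : p.+1%:R / L%:R < 1 :> R.
  by rewrite ltr_pdivrMr// mul1r (le_lt_trans _ hL)// le_max lexx orbT.
have L2 : (0 : R) < (2 * L%:R)^-1 by rewrite invr_gt0 mulr_gt0.
have L1 : (2 * L%:R)^-1 <= 2^-1 :> R.
  by rewrite lef_pV2 ?posrE ?mulr_gt0// ler_peMr// ler1n.
have [kap0 hkap] := ccos_gap L2 L1.
set kap := 1 - cos _ in kap0 hkap.
(* The factors [(1 + L exp (- sig)) ^ N] and [exp (sig th N)] of the count
   are each at most [exp (h N / 4)]. *)
pose sig := Num.max 1 (ln (4 * L%:R / h)).
have sig0 : 0 < sig by rewrite lt_max ltr01.
have Lh : 0 < 4 * L%:R / h by rewrite divr_gt0// mulr_gt0.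
have sigh : 1 + L%:R * expR (- sig) <= expR (h / 4).
  apply: le_trans (expR_ge1Dx (h / 4)); rewrite lerD2l.
  have -> : h / 4 = L%:R * (4 * L%:R / h)^-1 by field; rewrite !gt_eqF.
  rewrite ler_wpM2l// -[X in _ <= X^-1]lnK ?posrE// -expRN ler_expR lerN2.
  by rewrite le_max lexx orbT.
pose th := h / (4 * sig).
exists (kap * th) => [|F N0 F0]; first by rewrite mulr_gt0// divr_gt0// mulr_gt0.
pose C := (\sum_(n <- F) n * L)%N.
have [N [hN [E [EY sepE] cardE]]] := sep (N0 + (Num.truncn (2 * C%:R / h)).+1)%N.
have N0N : (N0 < N)%N by rewrite (leq_trans _ hN)// addnS ltnS leq_addr.
have N1 : (0 < N)%N := leq_ltn_trans (leq0n _) N0N.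
have NR0 : (0 : R) < N%:R by rewrite ltr0n.
exists N => //; apply: contrapT => no.
pose S n x := \sum_(i < N) (1 - ccos (x *+ (n * p ^ i))).
pose bad n x := S n x <= kap * th * N%:R.
have Ebad x : x \in E -> exists2 n, n \in F & bad n x.
  move=> xE; apply: contrapT => nobad; apply: no; exists x; first exact: EY.
  move=> n nF; rewrite leNgt; apply/negP => hlt; apply: nobad; exists n => //.
  rewrite /bad ltW//; move: hlt.
  have -> : 1 - avg N (fun l => ccos (x *+ (n * p ^ l))) = S n x / N%:R.
    have := avgB N (fun=> 1) (fun l => ccos (x *+ (n * p ^ l))).
    by rewrite (avg_cst 1 N1) => <-; rewrite mulrC.
  by rewrite ltr_pdivrMr.
have cardE_le : (#|` E| <= \sum_(n <- F) count (bad n) E)%N.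
  under eq_bigr do rewrite -sum1_count big_mkcond.
  rewrite exchange_big/= -sum1_size !big_seq leq_sum// => x /Ebad[n nF nx].
  by rewrite (big_rem n)//= nx.
have count_le n : n \in F ->
    (count (bad n) E)%:R <= (n * L)%:R * expR (h / 2 * N%:R).
  move=> nF; rewrite -size_filter.
  apply: le_trans (@card_near0_orbits_le p n N L _ kap sig th (F0 _ nF) _ Lp
    kap0 sig0 hkap _ _ _) _ => //.
  - exact/filter_uniq/fset_uniq.
  - by move=> x; rewrite mem_filter => /andP[].
  - move=> x y; rewrite !mem_filter => /andP[_ xE] /andP[_ yE] xy.
    by rewrite (le_lt_trans Le)// sepE.
  rewrite -mulrA ler_wpM2l//.
  have -> : h / 2 * N%:R = h / 4 * N%:R + sig * th * N%:R.
    by rewrite /th; field; rewrite gt_eqF.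
  rewrite expRD ler_wpM2r ?expR_ge0// expRM_natr.
  by rewrite lerXn2r ?nnegrE ?expR_ge0// addr_ge0// mulr_ge0// expR_ge0.
have : #|` E|%:R <= C%:R * expR (h / 2 * N%:R).
  apply: (@le_trans _ _ (\sum_(n <- F) count (bad n) E)%N%:R).
    by rewrite ler_nat.
  rewrite /C !natr_sum mulr_suml [leLHS]big_seq [leRHS]big_seq.
  by apply: ler_sum => n nF; exact: count_le.
rewrite leNgt => /negP[]; apply: le_lt_trans cardE.
have -> : h * N%:R = h / 2 * N%:R + h / 2 * N%:R by field.
rewrite expRD ler_wpM2r ?expR_ge0//.
apply: le_trans (expR_ge1Dx _); apply: ler_wpDl => //.
have : 2 * C%:R / h < (Num.truncn (2 * C%:R / h)).+1%:R by exact: truncnS_gt.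
rewrite ltr_pdivrMr// => hC.
have : (Num.truncn (2 * C%:R / h)).+1%:R * h <= N%:R * h :> R.
  by rewrite ler_pM2r// ler_nat (leq_trans _ hN)// leq_addl.
by lra.
Qed.

End coding.

(** * Dilates with a gap are rare *)

Section gaps.
Context {R : realType}.
Implicit Types (x y t v w : circle R) (n : nat) (e : R).

Lemma dilate_far_gap n (Y : hyperspace (circle R)) e :
  0 <= e -> e < mdist (dilate n Y) circle_full ->
  exists t, forall y, hyperspace_set Y y -> e <= circle_norm (y *+ n - t).
Proof.
move=> e0; rewrite ltNge => /negP far; apply: contrapT => nogap; apply: far.
rewrite -[leLHS]/(hausdorff_dist (dilate n Y) circle_full) ge_max.
apply/andP; split; apply: excess_le => a Aa.
  by rewrite (le_trans (@point_dist_le _ _ a a circle_full I))// mdistxx.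
rewrite leNgt; apply/negP => ae; apply: nogap; exists a => y Yy.
rewrite -circle_normN opprB -[leRHS]/(mdist a (y *+ n)).
rewrite (le_trans (ltW ae))//; apply: point_dist_le.
by exists y.
Qed.

(** The kernel argument needs a gap centre away from 0: a centre too close to
    0 is moved by half the radius. *)
Lemma gap_centre_away t e : 0 < e -> e <= 1 ->
  exists2 t', e / 4 <= circle_norm t' &
    forall w, e <= circle_norm (w - t) -> e / 4 <= circle_norm (w - t').
Proof.
move=> e0 e1; have [te|te] := leP (e / 4) (circle_norm t).
  by exists t => // w; lra.
pose v : circle R := circle_proj (e / 2).
have vE : circle_norm v = e / 2.
  by rewrite circle_norm_proj ger0_norm; lra.
exists (t + v) => [|w].
  have := circle_norm_triangle (t + v) (- t).
  by rewrite addrAC subrr add0r circle_normN vE; lra.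
have := circle_norm_triangle (w - (t + v)) v.
by rewrite opprD addrA subrK vE; lra.
Qed.

Lemma count_sum_le (s : seq nat) (P : pred nat) (c : R) (f : nat -> R) :
  (forall n, 0 <= f n) -> (forall n, n \in s -> P n -> c <= f n) ->
  (count P s)%:R * c <= \sum_(n <- s) f n.
Proof.
move=> f0; elim: s => [|a s IH] cf; first by rewrite big_nil mul0r.
rewrite big_cons/= natrD mulrDl lerD//; last first.
  by apply: IH => n ns; apply: cf; rewrite inE ns orbT.
have [Pa|_] := boolP (P a); last by rewrite mul0r.
by rewrite mul1r cf// inE eqxx.
Qed.

Lemma folner_almost_invariant (F : nat -> {fset nat}) Q (gam : R) :
  folner R F -> 0 < gam -> \forall m \near \oo, forall q, (0 < q <= Q)%N ->
    #|` fset_symdiff (fset_scale q (F m)) (F m)|%:R <= gam * #|` F m|%:R.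
Proof.
move=> [Fn0 _ Finv] gam0.
have H : \forall m \near \oo, forall q : 'I_Q.+1, (0 < q)%N ->
    #|` fset_symdiff (fset_scale q (F m)) (F m)|%:R <= gam * #|` F m|%:R.
  apply: filter_forall => q; have [q0|q0] := ltnP 0 q; last first.
    exact: nearW.
  have /cvgrPdist_le/(_ _ gam0) := Finv _ q0.
  apply: filterS => m; rewrite sub0r normrN ger0_norm ?divr_ge0// => h _.
  by move: h; rewrite ler_pdivrMr// ltr0n cardfs_gt0.
apply: filterS H => m H q /andP[q0 qQ].
by have := H (Ordinal (qQ : (q < Q.+1)%N)) q0.
Qed.

(** Along one orbit in [Y] chosen by the entropy lemma, all Fourier
    coefficients below frequency [K] of the dilated orbit measure are close,
    for most [n], to the first cosine coefficient. If the dilate by such an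
    [n] had a gap, the Fejer kernel would force this coefficient close to 1,
    against the entropy lemma. *)
Lemma far_dilates_rare p (Y : hyperspace (circle R)) (F : nat -> {fset nat}) e
    (be : R) :
  (2 <= p)%N -> times p @` Y = Y ->
  (0 < topological_entropy (@times R p) Y)%E -> folner R F ->
  0 < e -> 0 < be ->
  \forall m \near \oo,
    (count (fun n => e < mdist (dilate n Y) circle_full) (F m))%:R <=
    be * #|` F m|%:R.
Proof.
move=> p2 invY entY folF e0 be0.
have [eta eta0 orbit] := entropy_gt0_orbit_avg (hyperspace_neq0 Y) entY.
pose e1 := Num.min e 1.
have e10 : 0 < e1 by rewrite lt_min e0 ltr01.
have e11 : e1 <= 1 by rewrite ge_min lexx orbT.
have [kap0 hkap] := @ccos_gap R (e1 / 4) ltac:(lra) ltac:(lra).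
set kap := 1 - cos _ in kap0 hkap.
(* [K] and [tau] make the two error terms of the kernel estimate at most
   [eta / 4] each; [ze] is the mean square allowed per frequency by
   Chebyshev's inequality, shared equally between the number [M] of averaged
   dilations, the Folner defect [gam] and the edge effect of time [N]. *)
pose K := (Num.truncn (16 / (kap * eta))).+1.
have KR0 : (0 : R) < K%:R by rewrite ltr0n.
have hK : 4 / (K%:R * kap) <= eta / 4.
  have : 16 / (kap * eta) < K%:R by exact: truncnS_gt.
  rewrite ltr_pdivrMr ?mulr_gt0// => h.
  by rewrite ler_pdivrMr ?mulr_gt0//; move: h; lra.
pose tau := eta / (8 * K%:R).
have tau0 : 0 < tau by rewrite divr_gt0// mulr_gt0.
have hKtau : 2 * K%:R * tau = eta / 4 by rewrite /tau; field; rewrite gt_eqF.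
pose ze := be * tau ^+ 2 / (2 * K%:R).
have ze0 : 0 < ze by apply: divr_gt0; apply: mulr_gt0; rewrite ?exprn_gt0.
pose M := (Num.truncn (24 / ze)).+1.
have MR0 : (0 : R) < M%:R by rewrite ltr0n.
have hM : 2 * (4 / M%:R) <= ze / 3.
  have : 24 / ze < M%:R by exact: truncnS_gt.
  rewrite ltr_pdivrMr// => h.
  by rewrite mulrA ler_pdivrMr//; move: h; lra.
pose gam := ze / 24.
have gam0 : 0 < gam by rewrite divr_gt0.
pose ze1 := Num.min 1 (ze / 6).
have ze10 : 0 < ze1 by rewrite lt_min ltr01 divr_gt0.
pose N0 := Num.truncn (4 * (K * M)%:R / ze1).
have inv := folner_almost_invariant (2 * (p ^ K) ^ M.+1) folF gam0.
near=> m.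
have invm q : (0 < q <= 2 * (p ^ K) ^ M.+1)%N ->
    #|` fset_symdiff (fset_scale q (F m)) (F m)|%:R <= gam * #|` F m|%:R.
  by move: q; near: m.
have [_ Fpos _] := folF.
have [N N0N [x Yx hx]] := orbit (F m) N0 (Fpos m).
have Npos : (0 < N)%N := leq_ltn_trans (leq0n _) N0N.
have NR0 : (0 : R) < N%:R by rewrite ltr0n.
pose z l := x *+ p ^ l.
have zS l : z l.+1 = z l *+ p by rewrite /z expnSr mulrnA.
have zY l : hyperspace_set Y (z l).
  elim: l => [|l IH]; first by rewrite /z expn0 mulr1n.
  by rewrite zS -invY; exists (z l).
have flat : flat_spectrum N (F m) z (2 * (p ^ K) ^ M.+1) gam.
  move=> q qQ; pose G n := orbit_avg N z n ccos.
  have -> : total_avg N (F m) z (fun x => ccos (x *+ q)) =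
      \sum_(n <- F m) G (n * q)%N.
    by apply: eq_bigr => n _; apply: eq_avg => l _; rewrite mulrnA.
  apply: (le_trans (@sum_fset_dilate R (F m) q G _ _)).
  - by case/andP: qQ.
  - by move=> n; apply: avg_norm_le => // l _; exact: ccos_norm_le1.
  - exact: invm.
have hN : 2 * (4 * (K * M)%:R / N%:R) ^+ 2 <= ze / 3.
  set o := 4 * (K * M)%:R / N%:R.
  have o0 : 0 <= o by rewrite divr_ge0// mulr_ge0.
  have : o <= ze1.
    have lt0 : 4 * (K * M)%:R / ze1 < N0.+1%:R by exact: truncnS_gt.
    have le0 : N0.+1%:R <= N%:R :> R by rewrite ler_nat.
    rewrite ler_pdivrMr// [leRHS]mulrC -ler_pdivrMr//.
    exact: le_trans (ltW lt0) le0.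
  by rewrite le_min => /andP[le1 lez]; rewrite expr2; nra.
have fourier d : (0 < d < K)%N ->
    \sum_(n <- F m) orbit_avg N z n (fun x => csin (x *+ d)) ^+ 2 <=
      ze * #|` F m|%:R /\
    \sum_(n <- F m) (orbit_avg N z n (fun x => ccos (x *+ d)) -
      orbit_avg N z n ccos) ^+ 2 <= ze * #|` F m|%:R.
  move=> /andP[d0 dK].
  have dp : (0 < d < p ^ K)%N by rewrite d0 (ltn_trans dK)// ltn_expl.
  have [h1 h2] := sum_sqr_fourier_le zS (ltn0Sn _ : (0 < M)%N) (ltW gam0) dp flat.
  have B : (2 * (4 / M%:R + 4 * gam) + 2 * (4 * (K * M)%:R / N%:R) ^+ 2) *
      #|` F m|%:R <= ze * #|` F m|%:R.
    by rewrite ler_wpM2r//; move: hM hN; rewrite /gam; lra.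
  by split; [exact: le_trans h1 B|exact: le_trans h2 B].
pose dev n := \sum_(d < K | (0 < d)%N)
  (orbit_avg N z n (fun x => csin (x *+ d)) ^+ 2 +
   (orbit_avg N z n (fun x => ccos (x *+ d)) - orbit_avg N z n ccos) ^+ 2).
have term0 n (d : 'I_K) : 0 <= orbit_avg N z n (fun x => csin (x *+ d)) ^+ 2 +
   (orbit_avg N z n (fun x => ccos (x *+ d)) - orbit_avg N z n ccos) ^+ 2.
  by rewrite addr_ge0 ?sqr_ge0.
have dev_sum : \sum_(n <- F m) dev n <= be * tau ^+ 2 * #|` F m|%:R.
  rewrite /dev exchange_big/=.
  apply: (@le_trans _ _ (\sum_(d < K) 2 * (ze * #|` F m|%:R))).
    rewrite [leRHS](bigID (fun d : 'I_K => (0 < d)%N))/=.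
    rewrite ler_wpDr ?sumr_ge0// => [d _|]; first by rewrite !mulr_ge0// ltW.
    apply: ler_sum => d d0; rewrite big_split/=.
    have [h1 h2] := fourier d ltac:(by rewrite d0/=).
    by rewrite mulr_natl mulr2n lerD.
  rewrite sumr_ord_cst mulrA mulrA.
  by rewrite ler_wpM2r// /ze le_eqVlt; apply/orP; left; apply/eqP; field; rewrite gt_eqF.
have cheb : (count (fun n => e < mdist (dilate n Y) circle_full) (F m))%:R *
    tau ^+ 2 <= \sum_(n <- F m) dev n.
  apply: count_sum_le => [n|n nF far]; first exact: sumr_ge0.
  have [t gap] := dilate_far_gap (ltW e0) far.
  rewrite leNgt; apply/negP => devn.
  have [t' t'0 gap'] := gap_centre_away t e10 e11.
  have small (a : R) : a ^+ 2 <= tau ^+ 2 -> `|a| <= tau.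
    rewrite -[in X in X -> _](real_normK (num_real a)) => h.
    by rewrite -(@ler_pXn2r _ 2)// nnegrE// ltW.
  have low : 1 - avg N (fun l => ccos (z l *+ n)) <=
      4 / (K%:R * kap) + 2 * K%:R * tau.
    apply: (@one_sub_avg_ccos_le _ N K (fun l => z l *+ n) t' kap tau) => //.
    - exact: ltW.
    - exact: hkap.
    - move=> l _; apply: hkap; apply: gap'.
      by rewrite (le_trans _ (gap _ (zY l)))// ge_min lexx.
    move=> d /andP[d0 dK].
    have := devn; rewrite /dev (bigD1 (Ordinal dK))//=.
    set rest := \sum_(_ < _ | _) _ => h.
    have rest0 : 0 <= rest by rewrite sumr_ge0.
    set sd := orbit_avg _ _ _ (fun x => csin (x *+ d)) in h.
    set cd := orbit_avg _ _ _ (fun x => ccos (x *+ d)) - _ in h.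
    have hs : sd ^+ 2 <= tau ^+ 2.
      by apply: le_trans (ltW h); rewrite -addrA lerDl addr_ge0// sqr_ge0.
    have hc : cd ^+ 2 <= tau ^+ 2.
      by apply: le_trans (ltW h); rewrite addrAC lerDr addr_ge0// sqr_ge0.
    by split; [exact: small hc|exact: small hs].
  have := hx n nF; rewrite (@eq_avg _ _ _ (fun l => ccos (z l *+ n))); last first.
    by move=> l _; rewrite /z -mulrnA mulnC.
  by move: low hK; rewrite hKtau; lra.
rewrite -(@ler_pM2r _ (tau ^+ 2)) ?exprn_gt0// mulrAC.
exact: le_trans cheb dev_sum.
Unshelve. all: by end_near. Qed.

End gaps.

(** * Diagonal extraction *)

Lemma card_fset_filter (A : {fset nat}) (P : pred nat) :
  #|` [fset n in A | P n]%fset| = count P A.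
Proof.
rewrite -size_filter; apply/perm_size/uniq_perm.
- exact: fset_uniq.
- exact/filter_uniq/fset_uniq.
- by move=> n; rewrite mem_filter !inE andbC.
Qed.

(** Let the [A k] decrease and let each have density 1 along [F], with defect
    at most [1 / (k + 1)] from time [m_ k] on. The set [J] collects from each
    [F m] the points lying in all the [A k] with [m_ k <= m]; outside [A k] it
    only has points of finitely many [F m]. The bound [k <= m] makes the
    largest such [k] exist. *)
Lemma diagonal_density (R : realType) (F : nat -> {fset nat})
    (A : nat -> set nat) :
  (forall m, F m != fset0) -> (forall k l, (k <= l)%N -> A l `<=` A k) ->
  (forall k (be : R), 0 < be -> \forall m \near \oo,
     (count (fun n => n \notin A k) (F m))%:R <= be * #|` F m|%:R) ->
  exists J : set nat,
    [/\ forall n, J n -> exists m, n \in F m,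
        (#|` [fset n in F m | n \in J]%fset|%:R / #|` F m|%:R : R)
          @[m --> \oo] --> (1 : R) &
        forall k, \forall n \near \oo, J n -> A k n].
Proof.
move=> Fn0 Amono dens.
have FR0 m : (0 : R) < #|` F m|%:R by rewrite ltr0n cardfs_gt0.
have [mu hmu] : {mu : nat -> nat & forall k m, (mu k <= m)%N ->
    (count (fun n => n \notin A k) (F m))%:R <= k.+1%:R^-1 * #|` F m|%:R :> R}.
  apply: (@choice _ _ (fun k m0 => forall m, (m0 <= m)%N ->
    (count (fun n => n \notin A k) (F m))%:R <= k.+1%:R^-1 * #|` F m|%:R)) => k.
  have [m0 _ h] := dens k k.+1%:R^-1 ltac:(by rewrite invr_gt0).
  by exists m0 => m /h.
pose J := [set n | exists2 m, n \in F m &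
  forall k, (k <= m)%N -> (mu k <= m)%N -> A k n].
exists J; split => [n [m nF _]||k]; first by exists m.
  apply/cvgrPdist_le => be be0.
  pose k0 := Num.truncn be^-1.
  near=> m.
  pose P k := (k <= m)%N && (mu k <= m)%N.
  have Pk0 : P k0.
    by apply/andP; split; near: m; [exists k0|exists (mu k0)].
  have [k /andP[km muk] kmax] := @ex_maxnP P m (ex_intro P k0 Pk0)
    (fun k h => proj1 (andP h)).
  have count_le : (count (fun n => n \notin J) (F m) <=
      count (fun n => n \notin A k) (F m))%N.
    rewrite -!sum1_count big_seq_cond [leqRHS]big_seq_cond.
    apply: sub_le_big => //= [a b|n]; first exact: leq_addr.
    move=> /andP[nF nJ]; rewrite nF/=; apply: contra nJ => /set_mem nA.
    apply/mem_set; exists m => // l lm mul.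
    by apply: Amono nA; apply: kmax; rewrite /P lm mul.
  have cardF : #|` F m|%:R = (count (fun n => n \in J) (F m))%:R +
      (count (fun n => n \notin J) (F m))%:R :> R.
    by rewrite -natrD (count_predC (fun n => n \in J)).
  have bek : k.+1%:R^-1 <= be.
    rewrite -[be]invrK lef_pV2 ?posrE ?invr_gt0//.
    rewrite (le_trans (ltW (truncnS_gt _)))// ler_nat ltnS.
    exact: kmax.
  have -> : 1 - #|` [fset n in F m | n \in J]%fset|%:R / #|` F m|%:R =
      (count (fun n => n \notin J) (F m))%:R / #|` F m|%:R :> R.
    rewrite card_fset_filter -[X in X - _](@mulfV _ (#|` F m|%:R)) ?gt_eqF//.
    by rewrite -mulrBl {1}cardF addrAC subrr add0r.
  rewrite ger0_norm ?divr_ge0// ler_pdivrMr//.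
  apply: (@le_trans _ _ (k.+1%:R^-1 * #|` F m|%:R)); last by rewrite ler_wpM2r// ltW.
  by rewrite (le_trans _ (hmu k m muk))// ler_nat.
exists (\sum_(m < maxn k (mu k)) \sum_(n <- F m) n).+1%N => // n /= nbig [m nF nA].
have [/andP[km muk]|early] := boolP ((k <= m) && (mu k <= m))%N.
  exact: nA.
have mlt : (m < maxn k (mu k))%N by rewrite leq_max !ltnNge -negb_and.
move: nbig; rewrite ltnNge => /negP[].
by rewrite (bigD1 (Ordinal mlt))//= (big_rem n)//= -addnA leq_addr.
Unshelve. all: by end_near. Qed.

Theorem theorem1p3 (R : realType) (p : nat) (hp : (2 <= p)%N)
    (Y : hyperspace (circle R)) (invY : times p @` Y = Y)
    (entY : (0 < topological_entropy (@times R p) Y)%E)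
    (F : nat -> {fset nat}) (folF : folner R F) :
  exists J : set nat,
    [/\ J `<=` [set n | (0 < n)%N],
        (#|` [fset n in F m | n \in J]|%:R / #|` F m|%:R : R)
          @[m --> \oo] --> (1 : R) &
        dilate n Y @[n --> within J \oo] --> circle_full].
Proof.
have [Fn0 Fpos _] := folF.
pose A k := [set n | mdist (dilate n Y) circle_full <= k.+1%:R^-1].
have Amono k l : (k <= l)%N -> A l `<=` A k.
  move=> kl n /= h; rewrite /A/= (le_trans h)// lef_pV2 ?posrE//.
  by rewrite ler_nat ltnS.
have dens k (be : R) : 0 < be -> \forall m \near \oo,
    (count (fun n => n \notin A k) (F m))%:R <= be * #|` F m|%:R.
  move=> be0; have k0 : (0 : R) < k.+1%:R^-1 by rewrite invr_gt0.
  have := far_dilates_rare hp invY entY folF k0 be0.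
  apply: filterS => m; rewrite (@eq_count _ (fun n => n \notin A k)
    (fun n => k.+1%:R^-1 < mdist (dilate n Y) circle_full))// => n.
  by rewrite ltNge; congr (~~ _); apply/idP/idP => [/set_mem|h]//; exact/mem_set.
have [J [JF Jdens JA]] := diagonal_density Fn0 Amono dens.
exists J; split => //; first by move=> n /JF[m /Fpos].
apply/metricType_numDomainType.cvgrPdist_lt => e e0.
have [k ke] : exists k : nat, k.+1%:R^-1 < e.
  exists (Num.truncn e^-1); rewrite -[ltRHS]invrK ltf_pV2 ?posrE ?invr_gt0//.
  exact: truncnS_gt.
apply: filterS (JA k) => n h Jn; rewrite /= metric_sym.
exact: le_lt_trans (h Jn) ke.
Qed.
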